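(* Let $\mathrm{COMB}(n)$ be the polytope defined by the intersection of all comb inequalities for the TSP polytope $\mathrm{TSP}_n$ of $K_n$. Then the extension complexity of $\mathrm{COMB}(n)$ is at least $2^{\Omega(n)}$.
   Context: $\mathrm{TSP}_n$ is the convex hull of the characteristic vectors (in $\mathbb{R}^{E(K_n)}$) of Hamiltonian cycles of $K_n$. For a vertex subset $S$, $\delta(S)$ is the set of edges with exactly one endpoint in $S$, and $x(F)=\sum_{e\in F}x_e$. A comb in $K_n$ consists of a handle $H\subseteq V$ and teeth $T_1,\dots,T_k\subseteq V$, $k\geqslant 3$ odd, with $H\cap T_i\neq\emptyset$ for all $i$, $T_i\cap T_j=\emptyset$ for $i\neq j$, and $H\setminus\bigcup_iT_i\neq\emptyset$; the comb inequality is $x(\delta(H))+\sum_{i=1}^k x(\delta(T_i))\geqslant 3k+1$, valid for $\mathrm{TSP}_n$. The extension complexity of a polytope $P$ is the minimum number of facets of a polytope $Q$ that projects onto $P$.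
   Formalization: Combs also require each tooth to leave the handle (else the inequality is not valid for TSP_n); as COMB(n) is literally unbounded, the bound is proved for it with polyhedra Q as extensions, and also for its intersection with the degree equations x(δ(v)) = 2, which is a polytope. *)

(* Defs.v *)
From HB Require Import structures.
From mathcomp Require Import all_boot all_order all_algebra.
From mathcomp Require Import all_classical all_reals all_analysis.

Set Implicit Arguments.
Unset Strict Implicit.
Unset Printing Implicit Defensive.

Import Order.TTheory GRing.Theory Num.Theory.
Local Open Scope classical_set_scope.
Local Open Scope ring_scope.
Local Open Scope card_scope.

Definition polyhedron (R : realType) (d : nat) (Q : set 'rV[R]_d) : Prop :=
  exists (k : nat) (A : 'M[R]_(d, k)) (b : 'rV[R]_k),
    Q = [set y | forall j : 'I_k, (y *m A) 0 j <= b 0 j].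

(* Taking a = 0 shows that a nonempty Q is a face of itself. *)
Definition face (R : realType) (d : nat) (Q F : set 'rV[R]_d) : Prop :=
  F !=set0 /\
  exists (a : 'cV[R]_d) (beta : R),
    (forall y, Q y -> (y *m a) 0 0 <= beta) /\
    F = [set y | Q y /\ (y *m a) 0 0 = beta].

(* A facet is an inclusion-maximal face among those distinct from Q. *)
Definition facet (R : realType) (d : nat) (Q F : set 'rV[R]_d) : Prop :=
  [/\ face Q F, F <> Q &
      forall G, face Q G -> F `<=` G -> G <> Q -> G = F].

(* Q ranges over polyhedra rather than only over bounded ones, so that the
   notion also makes sense for unbounded P; for a polytope P the minimum is
   the same. *)
Definition has_extension (R : realType) (V : lmodType R) (P : set V)
    (m : nat) : Prop :=
  exists (d : nat) (Q : set 'rV[R]_d) (pi : {linear 'rV[R]_d -> V}),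
    [/\ polyhedron Q, [set F | facet Q F] #= `I_m & pi @` Q = P].

(* The value is 0 when P has no extension at all, so that a positive lower
   bound on [xc P] is never vacuous. *)
Definition xc (R : realType) (V : lmodType R) (P : set V) : nat :=
  match pselect (exists m, `[< has_extension P m >]) with
  | left h => ex_minn h
  | right _ => 0%N
  end.

Definition edge (n : nat) : finType := {e : {set 'I_n} | #|e| == 2%N}.

Definition cut (n : nat) (S : {set 'I_n}) : {set edge n} :=
  [set e : edge n | #|val e :&: S| == 1%N].

(* [R^o] is R seen as a module over itself: this makes the type of edge
   vectors an R-module. *)
Definition edge_vec (R : realType) (n : nat) : lmodType R :=
  {ffun edge n -> R^o}.

Definition edge_sum (R : realType) (n : nat) (x : {ffun edge n -> R^o})
    (F : {set edge n}) : R :=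
  \sum_(e in F) x e.

(* The condition that every tooth leaves the handle is part of the standard
   definition of a comb; if some tooth lies inside the handle, the comb
   inequality is violated by a Hamiltonian cycle. *)
Definition comb (n k : nat) (H : {set 'I_n}) (T : 'I_k -> {set 'I_n}) : Prop :=
  [/\ (3 <= k)%N /\ odd k,
      forall i, H :&: T i != finset.set0,
      forall i, T i :\: H != finset.set0,
      forall i j, i != j -> T i :&: T j = finset.set0 &
      (H :\: \bigcup_(i < k) T i)%SET != finset.set0].

Definition COMB (R : realType) (n : nat) : set (edge_vec R n) :=
  [set x | forall (k : nat) (H : {set 'I_n}) (T : 'I_k -> {set 'I_n}),
     comb H T ->
     (3 * k + 1)%:R <=
       edge_sum x (cut H) + \sum_(i < k) edge_sum x (cut (T i))].
Arguments COMB : clear implicits.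

(* The comb inequalities have nonnegative coefficients, so COMB is an
   unbounded polyhedron.  Its intersection with the affine hull of the TSP
   polytope, given by the degree equations, is bounded for n >= 8. *)
Definition COMB_deg (R : realType) (n : nat) : set (edge_vec R n) :=
  [set x | COMB R n x /\ forall v : 'I_n, edge_sum x (cut [set v]%SET) = 2].
Arguments COMB_deg : clear implicits.

(* Main.v *)
Require Import Defs.
From HB Require Import structures.
From mathcomp Require Import all_boot all_order all_algebra.
From mathcomp Require Import all_classical all_reals all_analysis.
From mathcomp Require Import zify ring lra.

Set Implicit Arguments.
Unset Strict Implicit.
Unset Printing Implicit Defensive.

(** A face of a polyhedron that misses a point lies in a facet missing it.
    Hence, if [P] is the projection of a polyhedron with [r] facets and if points
    and valid inequalities of [P], both indexed by subsets of [[m]], have zero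
    slack exactly when the two subsets meet in one element, then [r + 1]
    rectangles without such pairs cover all disjoint pairs of subsets; by Kaibel
    and Weltge each contains at most [2^m] of the [3^m] disjoint pairs.

    The vertices of the complete graph are split into a hub [h] and an odd number
    [k] of paths [a_i - c_i - b_i], the vertex [c_i] existing only for [i < m].
    The subset [y] of [[m]] yields the comb with the paths as teeth and with
    handle [{h} + {a_i} + {c_i : i in y}].  These combs are tight on all tours
    that traverse the paths in any order, in alternating directions.  Conversely,
    a comb tight on all these tours has its teeth inside the paths, and its handle
    or the complement thereof contains all [a_i] and no [b_i].  So the average
    of these tours may be moved slightly in any direction that is nonnegative on
    the latter combs.  Since edge weights are not required to be nonnegative,
    there are such directions, of degree zero, whose value on the comb of [y] is
    [4 (1 - |x /\ y|)^2]. *)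

(** * Disjoint pairs in rectangles *)

Fixpoint common (x y : bitseq) : nat :=
  match x, y with
  | a :: x', b :: y' => (a && b) + common x' y'
  | _, _ => 0
  end.

(** A coordinate of a disjoint pair has three possible states, whence [3 ^ m] terms. Recursion on
    the first coordinate matches the induction used for rectangles. *)
Fixpoint disjoint_sum (m : nat) (F : bitseq -> bitseq -> nat) : nat :=
  if m is m'.+1 then
    disjoint_sum m' (fun x y => F (false :: x) (false :: y)) +
    disjoint_sum m' (fun x y => F (true :: x) (false :: y)) +
    disjoint_sum m' (fun x y => F (false :: x) (true :: y))
  else F [::] [::].

Lemma disjoint_sum_ge3 m F :
  (forall x y, size x = m -> size y = m -> common x y = 0 -> 0 < F x y) ->
  3 ^ m <= disjoint_sum m F.
Proof.
elim: m F => [|m IH] F pF; first by rewrite expn0 pF.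
have s1 a b : (a && b) = false ->
    3 ^ m <= disjoint_sum m (fun x y => F (a :: x) (b :: y)).
  by move=> ab; apply: IH => x y sx sy xy; apply: pF; rewrite /= ?sx ?sy // ab.
rewrite expnS /=.
have := s1 false false erefl; have := s1 true false erefl.
have := s1 false true erefl; lia.
Qed.

Lemma leq_disjoint_sum m F G :
  (forall x y, size x = m -> size y = m -> common x y = 0 -> F x y <= G x y) ->
  disjoint_sum m F <= disjoint_sum m G.
Proof.
elim: m F G => [|m IH] F G FG /=; first by apply: FG.
by rewrite !leq_add //; apply: IH => x y sx sy xy; apply: FG; rewrite /= ?sx ?sy.
Qed.

Lemma disjoint_sumD m F G :
  disjoint_sum m (fun x y => F x y + G x y) = disjoint_sum m F + disjoint_sum m G.
Proof. by elim: m F G => [|m IH] F G //=; rewrite !IH; lia. Qed.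

Lemma disjoint_sum0 m : disjoint_sum m (fun _ _ => 0) = 0.
Proof. by elim: m => //= m ->. Qed.

Lemma eq_disjoint_sum m F G : (forall x y, F x y = G x y) ->
  disjoint_sum m F = disjoint_sum m G.
Proof. by elim: m F G => [|m IH] F G FG //=; do 2?congr (_ + _); apply: IH. Qed.

Lemma disjoint_sum_big m r (F : 'I_r -> bitseq -> bitseq -> nat) :
  disjoint_sum m (fun x y => \sum_(j < r) F j x y) =
  \sum_(j < r) disjoint_sum m (F j).
Proof.
elim: r F => [|r IH] F.
  rewrite big_ord0; apply: etrans (disjoint_sum0 m).
  by apply: eq_disjoint_sum => x y; rewrite big_ord0.
rewrite big_ord_recl -IH -disjoint_sumD; apply: eq_disjoint_sum => x y.
by rewrite big_ord_recl.
Qed.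

(* Kaibel and Weltge: splitting on the first coordinate, the pairs of [A x B]
   project to two rectangles with the same property, because [true :: x] in [A]
   and [true :: y] in [B] with [x], [y] disjoint is excluded. *)
Lemma rectangle_disjoint_sum m (A B : pred bitseq) :
  (forall x y, size x = m -> size y = m -> A x -> B y -> common x y != 1) ->
  disjoint_sum m (fun x y => A x && B y) <= 2 ^ m.
Proof.
elim: m A B => [|m IH] A B AB; first by rewrite expn0 /=; case: (_ && _).
pose A0 x := A (false :: x); pose A1 x := A (true :: x).
pose B0 x := B (false :: x); pose B1 x := B (true :: x).
pose F1 x y : nat := (A0 x || A1 x) && B0 y.
pose F2 x y : nat := A0 x && (B0 y || B1 y).
have h1 : disjoint_sum m F1 <= 2 ^ m.
  apply: (IH (fun x => A0 x || A1 x)) => x y sx sy.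
  case/orP=> ax yB; first by apply: (AB (false :: x) (false :: y)); rewrite /= ?sx ?sy.
  by apply: (AB (true :: x) (false :: y)); rewrite /= ?sx ?sy.
have h2 : disjoint_sum m F2 <= 2 ^ m.
  apply: (IH A0 (fun y => B0 y || B1 y)) => x y sx sy ax.
  case/orP=> yB; first by apply: (AB (false :: x) (false :: y)); rewrite /= ?sx ?sy.
  by apply: (AB (false :: x) (true :: y)); rewrite /= ?sx ?sy.
rewrite expnS mul2n -addnn; apply: leq_trans (leq_add h1 h2).
rewrite -disjoint_sumD /= -!disjoint_sumD.
apply: leq_disjoint_sum => x y sx sy xy.
have : ~~ (A1 x && B1 y).
  apply/negP => /andP[xA yB].
  by have := AB (true :: x) (true :: y); rewrite /= sx sy xy => /(_ erefl erefl xA yB).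
rewrite /F1 /F2 /A0 /A1 /B0 /B1.
by case: (A (false :: x)); case: (A (true :: x)); case: (B (false :: y));
  case: (B (true :: y)).
Qed.

(** Double counting: the sum over the rectangles counts every disjoint pair at least once, and each
    rectangle contributes at most [2 ^ m]. *)
Lemma rectangle_cover m r (A B : 'I_r -> pred bitseq) :
  (forall j x y, size x = m -> size y = m -> A j x -> B j y -> common x y != 1) ->
  (forall x y, size x = m -> size y = m -> common x y = 0 ->
     exists j, A j x && B j y) ->
  3 ^ m <= r * 2 ^ m.
Proof.
move=> AB cov.
apply: (@leq_trans (disjoint_sum m (fun x y => \sum_(j < r) (A j x && B j y)))).
  apply: disjoint_sum_ge3 => x y sx sy xy.
  by have [j Pj] := cov x y sx sy xy; rewrite (bigD1 j) //= Pj.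
rewrite disjoint_sum_big -[r in r * _]card_ord -sum_nat_const leq_sum // => j _.
exact/rectangle_disjoint_sum/AB.
Qed.

(** * Combs on closed walks *)

Definition cross (V : Type) (S : V -> bool) (u v : V) : nat := S u (+) S v.

Lemma crossC (V : Type) (S : V -> bool) u v : cross S u v = cross S v u.
Proof. by rewrite /cross addbC. Qed.

Definition walk_cost (V : Type) (c : V -> V -> nat) (x : V) (t : seq V) : nat :=
  \sum_(p <- pairmap pair x t) c p.1 p.2.

Lemma walk_cost_nil (V : Type) (c : V -> V -> nat) x : walk_cost c x [::] = 0.
Proof. by rewrite /walk_cost big_nil. Qed.

Lemma walk_cost_cons (V : Type) (c : V -> V -> nat) x y t :
  walk_cost c x (y :: t) = c x y + walk_cost c y t.
Proof. by rewrite /walk_cost big_cons. Qed.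

Lemma walk_cost_cat (V : Type) (c : V -> V -> nat) x s t :
  walk_cost c x (s ++ t) = walk_cost c x s + walk_cost c (last x s) t.
Proof. by rewrite /walk_cost pairmap_cat big_cat. Qed.

Lemma odd_walk_cross (V : Type) (S : V -> bool) x t :
  odd (walk_cost (cross S) x t) = S x (+) S (last x t).
Proof.
elim: t x => [|y t IH] x /=; first by rewrite walk_cost_nil addbb.
by rewrite walk_cost_cons oddD IH oddb; case: (S x); case: (S y); case: (S _).
Qed.

Lemma walk_cross_eq0 (V : eqType) (S : V -> bool) x t :
  walk_cost (cross S) x t = 0 -> {in t, forall v, S v = S x}.
Proof.
elim: t x => [|y t IH] x //; rewrite walk_cost_cons => /eqP.
rewrite addn_eq0 => /andP[/eqP xy /eqP/IH yt] v.
have {}xy : S y = S x by move: xy; rewrite /cross; case: (S x); case: (S y).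
by rewrite inE => /orP[/eqP->//|/yt ->].
Qed.

(** The walk starts at the last vertex of [t], which closes it up; [x0] is the default for the empty
    list. *)
Definition cycle_cost (V : Type) (c : V -> V -> nat) (x0 : V) (t : seq V) : nat :=
  walk_cost c (last x0 t) t.

Lemma cycle_cross_even (V : Type) (S : V -> bool) x0 t :
  ~~ odd (cycle_cost (cross S) x0 t).
Proof.
by rewrite odd_walk_cross; case: t => [|y t] /=; rewrite addbb.
Qed.

(** A closed walk crosses a cut an even number of times, and not zero times if it visits both
    sides. *)
Lemma cycle_cross_ge2 (V : eqType) (S : V -> bool) x0 t u v :
  u \in t -> v \in t -> S u -> ~~ S v -> 2 <= cycle_cost (cross S) x0 t.
Proof.
move=> ut vt Su Sv; have := cycle_cross_even S x0 t.
case e : (cycle_cost _ _ _) => [|[|n]] //.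
by move: Sv; rewrite (walk_cross_eq0 e vt) -(walk_cross_eq0 e ut) Su.
Qed.

Section CombOnCycle.
Variables (V : eqType) (K : nat) (H : V -> bool) (T : 'I_K -> V -> bool).
Variables (x0 : V) (t : seq V).
Hypothesis T_disjoint : forall i j v, T i v -> T j v -> i = j.
Hypothesis T_in : forall i, exists v, [/\ v \in t, T i v & H v].
Hypothesis T_out : forall i, exists v, [/\ v \in t, T i v & ~~ H v].
Hypothesis K_gt1 : 1 < K.

Definition comb_cost u v : nat := cross H u v + \sum_(j < K) cross (T j) u v.

Let TH j v := T j v && H v.
Let TnH j v := T j v && ~~ H v.

Lemma cycle_comb_cost : cycle_cost comb_cost x0 t =
  cycle_cost (cross H) x0 t + \sum_(j < K) cycle_cost (cross (T j)) x0 t.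
Proof. by rewrite /cycle_cost /walk_cost big_split /= exchange_big. Qed.

(** Cutting a tooth along the handle adds twice the edges inside the tooth that cross the handle. As
    the teeth are disjoint, an edge lies inside at most one of them. *)
Lemma cross_teeth u v :
  \sum_(j < K) (cross (TH j) u v + cross (TnH j) u v) <=
  \sum_(j < K) cross (T j) u v + 2 * cross H u v.
Proof.
have e j : cross (TH j) u v + cross (TnH j) u v =
    cross (T j) u v + 2 * (T j u && T j v && (H u (+) H v)).
  rewrite /cross /TH /TnH.
  by case: (T j u); case: (T j v); case: (H u); case: (H v).
rewrite (eq_bigr _ (fun j _ => e j)) big_split /= leq_add2l -big_distrr /= leq_mul2l /=.
have [/existsP[j0 /andP[u0 v0]]|] := boolP [exists j, T j u && T j v]; last first.
  by move/existsPn => no; rewrite big1 // => j _; rewrite (negbTE (no j)).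
rewrite (bigD1 j0) //= u0 v0 big1 ?addn0 // => j jj0.
by case: (boolP (T j u)) => // ju; rewrite (T_disjoint ju u0) eqxx in jj0.
Qed.

Lemma cycle_teeth :
  \sum_(j < K) (cycle_cost (cross (T j)) x0 t + (cycle_cost (cross (TH j)) x0 t +
     cycle_cost (cross (TnH j)) x0 t)) <= 2 * cycle_cost comb_cost x0 t.
Proof.
rewrite cycle_comb_cost big_split /=.
suff : \sum_(j < K) (cycle_cost (cross (TH j)) x0 t + cycle_cost (cross (TnH j)) x0 t)
    <= \sum_(j < K) cycle_cost (cross (T j)) x0 t + 2 * cycle_cost (cross H) x0 t.
  rewrite -(leq_add2l (\sum_(j < K) cycle_cost (cross (T j)) x0 t)) => /leq_trans; apply.
  by rewrite addnA addnn -mul2n addnC -mulnDr.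
have -> : \sum_(j < K) (cycle_cost (cross (TH j)) x0 t +
     cycle_cost (cross (TnH j)) x0 t) =
   \sum_(p <- pairmap pair (last x0 t) t)
      \sum_(j < K) (cross (TH j) p.1 p.2 + cross (TnH j) p.1 p.2).
  rewrite exchange_big /=; apply: eq_bigr => j _.
  by rewrite /cycle_cost /walk_cost big_split.
have -> : \sum_(j < K) cycle_cost (cross (T j)) x0 t + 2 * cycle_cost (cross H) x0 t =
   \sum_(p <- pairmap pair (last x0 t) t)
      (\sum_(j < K) cross (T j) p.1 p.2 + 2 * cross H p.1 p.2).
  by rewrite big_split /= -big_distrr exchange_big.
by apply: leq_sum => p _; apply: cross_teeth.
Qed.

(** A second tooth supplies the vertex outside [T j]. *)
Lemma tooth_cut_ge2 j : 2 <= cycle_cost (cross (T j)) x0 t.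
Proof.
have [u [ut Tu _]] := T_in j.
have [j' jj'] : exists j', j' != j.
  have [->|j0] := eqVneq j (Ordinal (ltnW K_gt1)); first by exists (Ordinal K_gt1).
  by exists (Ordinal (ltnW K_gt1)); rewrite eq_sym.
have [v [vt Tv _]] := T_in j'.
apply: (cycle_cross_ge2 _ ut vt) => //.
by apply/negP => /(T_disjoint Tv) e; rewrite e eqxx in jj'.
Qed.

Lemma tooth_parts_ge2 j : 2 <= cycle_cost (cross (TH j)) x0 t /\
  2 <= cycle_cost (cross (TnH j)) x0 t.
Proof.
have [u [ut Tu Hu]] := T_in j; have [v [vt Tv Hv]] := T_out j; split.
  by apply: (cycle_cross_ge2 _ ut vt); rewrite /TH ?Tu ?Hu // (negbTE Hv) andbF.
by apply: (cycle_cross_ge2 _ vt ut); rewrite /TnH ?Tv ?Hv // Hu andbF.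
Qed.

(* The comb inequality for tours: each tooth contributes at least 3, and the
   total is even. *)
Lemma comb_valid : odd K -> 3 * K + 1 <= cycle_cost comb_cost x0 t.
Proof.
move=> oK.
have ev : ~~ odd (cycle_cost comb_cost x0 t).
  rewrite cycle_comb_cost oddD (negbTE (cycle_cross_even _ _ _)) /=.
  elim/big_ind: _ => // [a b|j _]; last exact: cycle_cross_even.
  by rewrite oddD => /negbTE-> /negbTE->.
have : 6 * K <= 2 * cycle_cost comb_cost x0 t.
  apply: leq_trans cycle_teeth.
  rewrite mulnC -{1}[K]card_ord -sum_nat_const leq_sum // => j _.
  by have := tooth_cut_ge2 j; have := tooth_parts_ge2 j; lia.
have [c ec] : exists c, K = c.*2.+1 by exists K./2; rewrite -[LHS]odd_double_half oK.
have [d ed] : exists d, cycle_cost comb_cost x0 t = d.*2.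
  by exists (cycle_cost comb_cost x0 t)./2; rewrite -[LHS]odd_double_half (negbTE ev).
by rewrite ed ec; lia.
Qed.

(** In [cycle_teeth] the right side is now at most [6 * K + 2], and each other tooth takes at least
    6. This leaves 8 for tooth [j], of which its parts inside and outside the handle take at least
    4. *)
Lemma tight_tooth_le4 j : cycle_cost comb_cost x0 t <= 3 * K + 1 ->
  cycle_cost (cross (T j)) x0 t <= 4.
Proof.
move=> tight; have := cycle_teeth; rewrite (bigD1 j) //=.
have : 6 * K.-1 <= \sum_(i < K | i != j) (cycle_cost (cross (T i)) x0 t +
    (cycle_cost (cross (TH i)) x0 t + cycle_cost (cross (TnH i)) x0 t)).
  rewrite mulnC -{1}[K]card_ord -(cardC1 j) -sum_nat_const leq_sum // => i _.
  by have := tooth_cut_ge2 i; have := tooth_parts_ge2 i; lia.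
move: (\sum_(i < K | i != j) _) => s.
by have := tooth_parts_ge2 j; rewrite /TH /TnH; lia.
Qed.

End CombOnCycle.

(** * The gadget *)

Lemma sum_le_eq (I : finType) (f g : I -> nat) :
  (forall i, f i <= g i) -> \sum_i g i <= \sum_i f i -> forall i, f i = g i.
Proof.
move=> fg le i; apply/eqP; rewrite eqn_leq fg /=.
move: le; rewrite (bigD1 i) //= [X in _ <= X](bigD1 i) //=.
have : \sum_(j | j != i) f j <= \sum_(j | j != i) g j by apply: leq_sum.
by lia.
Qed.

Section Gadget.
Variables k m : nat.

Definition vertex := option ('I_k + 'I_k + 'I_m).
Definition slot := option 'I_k.
HB.instance Definition _ := Finite.on vertex.
HB.instance Definition _ := Finite.on slot.

Definition hub : vertex := None.
Definition top_end (i : 'I_k) : vertex := Some (inl (inl i)).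
Definition bot_end (i : 'I_k) : vertex := Some (inl (inr i)).
Definition mid (j : 'I_m) : vertex := Some (inr j).

(* The hub is a one-vertex path, so it is both of its own endpoints. *)
Definition endpoint (d : bool) (i : slot) : vertex :=
  if i is Some i' then if d then top_end i' else bot_end i' else hub.

Definition middle (i : 'I_k) : seq vertex :=
  if insub (i : nat) is Some j then [:: mid j] else [::].

Lemma middleP i :
  middle i = [::] \/ exists2 j : 'I_m, i = j :> nat & middle i = [:: mid j].
Proof.
by rewrite /middle; case: insubP => [j _ ji|_]; [right; exists j|left].
Qed.

Definition segment (d : bool) (i : slot) : seq vertex :=
  if i is Some i' then rcons (middle i') (endpoint (~~ d) i) else [::].

(** Consecutive paths are traversed in opposite directions, so every link between paths joins two
    top ends or two bottom ends, the hub counting as both. *)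
Fixpoint tour (d : bool) (s : seq slot) : seq vertex :=
  if s is i :: s' then endpoint d i :: segment d i ++ tour (~~ d) s' else [::].

Lemma last_segment d i : last (endpoint d i) (segment d i) = endpoint (~~ d) i.
Proof. by case: i => //= i; rewrite last_rcons. Qed.

Lemma last_tour d j s :
  last (endpoint d j) (tour d s) = endpoint (d (+) odd (size s)) (last j s).
Proof.
elim: s d j => [|i s IH] d j /=; first by rewrite addbF.
by rewrite last_cat last_segment IH addNb addbN.
Qed.

Section Costs.
Variable c : vertex -> vertex -> nat.
Hypothesis cC : forall u v, c u v = c v u.

Definition path_cost (i : slot) := walk_cost c (endpoint true i) (segment true i).

Lemma path_cost_dir d i : walk_cost c (endpoint d i) (segment d i) = path_cost i.
Proof.
case: d => //; rewrite /path_cost; case: i => //= i.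
case: (middleP i) => [->|[j _ ->]] /=; rewrite !walk_cost_cons !walk_cost_nil !addn0 //.
by rewrite addnC cC [in RHS]cC; congr (_ + _); rewrite cC.
Qed.

Fixpoint link_cost (d : bool) (j : slot) (s : seq slot) : nat :=
  if s is i :: s' then c (endpoint d j) (endpoint d i) + link_cost (~~ d) i s'
  else 0.

Lemma walk_cost_tour d j s :
  walk_cost c (endpoint d j) (tour d s) =
  \sum_(i <- s) path_cost i + link_cost d j s.
Proof.
elim: s d j => [|i s IH] d j /=; first by rewrite walk_cost_nil big_nil.
rewrite walk_cost_cons walk_cost_cat last_segment IH path_cost_dir big_cons; lia.
Qed.

Lemma cycle_cost_tour d s : ~~ odd (size s) ->
  cycle_cost c hub (tour d s) =
  \sum_(i <- s) path_cost i + link_cost d (last None s) s.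
Proof.
move=> es; rewrite /cycle_cost -walk_cost_tour; congr walk_cost.
by have := last_tour d None s; rewrite (negbTE es) addbF.
Qed.

End Costs.

(** On each side [d], all ends but at most one have the value [be d]. The number of times a tour
    crosses such a set does not depend on the order of the paths. *)
Definition near (S : vertex -> bool) (be : bool -> bool) := forall d i j,
  i != j -> (S (endpoint d i) == be d) || (S (endpoint d j) == be d).

(** The crossings charged to path [i]: its own crossed edges, and the link at each exceptional
    end. *)
Definition slot_cut (S : vertex -> bool) (be : bool -> bool) (i : slot) : nat :=
  (S (endpoint true i) != be true) + path_cost (cross S) i +
  (S (endpoint false i) != be false).

(** A link never joins two exceptional ends, so it is crossed exactly when one of its ends is
    exceptional. The extra terms, for the final and the initial end of the walk, cancel once the
    walk is closed. *)
Lemma link_cost_near S be d j s : near S be ->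
  path [rel x y | x != y] j s ->
  link_cost (cross S) d j s +
    (S (endpoint (d (+) odd (size s)) (last j s)) != be (d (+) odd (size s))) =
  (S (endpoint d j) != be d) +
  \sum_(i <- s) ((S (endpoint true i) != be true) + (S (endpoint false i) != be false)).
Proof.
move=> nS; elim: s d j => [|i s IH] d j /=; first by rewrite big_nil addbF addn0.
case/andP=> ji /(IH (~~ d)); rewrite addNb addbN big_cons => IHs.
rewrite -addnA IHs {IHs IH}; move: (\sum_(_ <- _) _) => z.
have := nS d j i ji; rewrite /cross; case: d => /=;
  by case: (S _); case: (S _); case: (S _); case: (be _); case: (be _) => //=; lia.
Qed.

Lemma tour_cut S be d s : near S be -> uniq s -> ~~ odd (size s) ->
  cycle_cost (cross S) hub (tour d s) = \sum_(i <- s) slot_cut S be i.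
Proof.
move=> nS us es; rewrite cycle_cost_tour //; last exact: crossC.
have [->|s0] := eqVneq s [::]; first by rewrite !big_nil.
have ps : path [rel x y | x != y] (last None s) s.
  case: s us es s0 => // i [|j s] // us _ _.
  have pw : pairwise [rel x y : slot | x != y] (i :: j :: s) by rewrite -uniq_pairwise.
  have := pairwise_sorted pw; rewrite /= => ->; rewrite andbT.
  move: us => /= /andP[+ _]; apply: contraNneq => <-; exact: mem_last.
have := link_cost_near d nS ps; rewrite (negbTE es) addbF.
have -> : last (last None s) s = last None s by case: s {us es ps} s0.
rewrite addnC => /addnI ->; rewrite -big_split /=.
by apply: eq_bigr => i _; rewrite /slot_cut; lia.
Qed.

(** From the prescribed value [be true] on one side to [be false] on the other, the value changes
    somewhere along the path. *)
Lemma slot_cut_ge1 S (be : bool -> bool) i : be true != be false ->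
  0 < slot_cut S be i.
Proof.
rewrite /slot_cut /path_cost; case: i => [i|] /=; last first.
  by rewrite walk_cost_nil; case: (S _); case: (be _); case: (be _).
case: (middleP i) => [->|[j _ ->]] /=; rewrite !walk_cost_cons walk_cost_nil /cross.
  by case: (S (top_end i)); case: (S (bot_end i)); case: (be _); case: (be _).
by case: (S (top_end i)); case: (S (mid j)); case: (S (bot_end i)); case: (be _); case: (be _).
Qed.

Hypothesis m_le_k : m <= k.

Definition slot_of (v : vertex) : slot :=
  match v with
  | None => None
  | Some (inl (inl i)) | Some (inl (inr i)) => Some i
  | Some (inr j) => Some (widen_ord m_le_k j)
  end.

Lemma middle_widen (j : 'I_m) i : i = widen_ord m_le_k j -> middle i = [:: mid j].
Proof.
move=> ->; rewrite /middle insubT //= => jm; congr [:: mid _]; exact: val_inj.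
Qed.

Lemma mem_tour d s v : slot_of v \in s -> v \in tour d s.
Proof.
elim: s d => //= i s IH d; rewrite inE => /orP[/eqP e|/IH]; last first.
  by move=> /(_ (~~ d)) h; rewrite inE mem_cat h !orbT.
rewrite inE mem_cat -e.
clear; case: v => [[[i1|i1]|j]|] //=; rewrite ?mem_rcons ?inE.
- by case: d; rewrite /top_end /= eqxx ?orbT.
- by case: d; rewrite /bot_end /= eqxx ?orbT.
by rewrite (middle_widen erefl) inE eqxx !orbT.
Qed.

(** The value leaves [be true] before [v] and returns to it after [v]. *)
Lemma slot_cut_ge2 S (be : bool -> bool) v : be true = be false ->
  S v != be true -> 1 < slot_cut S be (slot_of v).
Proof.
rewrite /slot_cut /path_cost => <-.
case: v => [[[i|i]|j]|] /=; last first.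
- by rewrite walk_cost_nil; case: (S _); case: (be _).
- rewrite (middle_widen erefl) /= !walk_cost_cons walk_cost_nil /cross.
  by case: (S (mid j)); case: (S (top_end _)); case: (S (bot_end _)); case: (be _).
- case: (middleP i) => [->|[j _ ->]] /=; rewrite !walk_cost_cons walk_cost_nil /cross.
    by case: (S (top_end i)); case: (S (bot_end i)); case: (be _).
  by case: (S (top_end i)); case: (S (mid j)); case: (S (bot_end i)); case: (be _).
- case: (middleP i) => [->|[j _ ->]] /=; rewrite !walk_cost_cons walk_cost_nil /cross.
    by case: (S (top_end i)); case: (S (bot_end i)); case: (be _).
  by case: (S (top_end i)); case: (S (mid j)); case: (S (bot_end i)); case: (be _).
Qed.

Lemma path_cost_cross_gt0 S u v : slot_of u = slot_of v -> S u != S v ->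
  0 < path_cost (cross S) (slot_of u).
Proof.
move=> uv Suv; rewrite lt0n; apply: contraNneq Suv => e0.
have const w : slot_of w = slot_of u -> S w = S (endpoint true (slot_of u)).
  case/boolP: (w == endpoint true (slot_of u)) => [/eqP <- //|nw e].
  apply: (walk_cross_eq0 e0); rewrite -e; rewrite -e in nw.
  case: w {e} nw => [[[i|i]|j]|] //=; rewrite ?mem_rcons ?inE ?eqxx //.
  by rewrite (middle_widen erefl) inE eqxx orbT.
by rewrite (const u) // (const v).
Qed.

Lemma card_slot_le3 i (s : seq vertex) :
  uniq s -> all [pred v | slot_of v == i] s -> size s <= 3.
Proof.
pose kind (v : vertex) : 'I_3 :=
  match v with
  | None | Some (inl (inl _)) => inord 0
  | Some (inl (inr _)) => inord 1
  | Some (inr _) => inord 2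
  end.
move=> us /allP si.
have inj : {in s &, injective kind}.
  move=> u v /si/eqP eu /si/eqP ev e; have := congr1 val e; move: eu; rewrite -ev.
  case: u v {e ev} => [[[a|a]|a]|] [[[b|b]|b]|] //=; rewrite /kind /= ?inordK //.
  - by case=> ->.
  - by case=> ->.
  - by move=> e _; congr (Some (inr _)); case: e => e; apply/val_inj.
rewrite -(size_map kind); apply: (@leq_trans (size (enum 'I_3))).
  by apply: uniq_leq_size => [|j _]; rewrite ?map_inj_in_uniq ?mem_enum.
by rewrite size_enum_ord.
Qed.

End Gadget.

(** * Combs tight on all tours *)

Lemma sum_option (I : finType) (f : option I -> nat) :
  \sum_i f i = f None + \sum_i f (Some i).
Proof.
rewrite (bigD1 None) //=; congr (_ + _).
rewrite (reindex_omap Some id) /=; last by case.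
by apply: eq_bigl => i; rewrite eqxx.
Qed.

Section TightCombs.
Variables (k m : nat) (m_le_k : m <= k).
Hypotheses (k_odd : odd k) (k_gt4 : 4 < k).
Notation V := (vertex k m).
Notation slot := (slot k).
Notation sl := (slot_of m_le_k).
Notation hub := (hub k m).
Notation endpoint := (@endpoint k m).
Notation tour := (@tour k m).

Variables (K : nat) (H : V -> bool) (T : 'I_K -> V -> bool).
Hypothesis T_disjoint : forall i j v, T i v -> T j v -> i = j.
Hypothesis T_in : forall i, exists v, T i v && H v.
Hypothesis T_out : forall i, exists v, T i v && ~~ H v.
Hypotheses (K_odd : odd K) (K_gt2 : 2 < K).

Lemma even_slots s : perm_eq s (enum {: slot}) -> ~~ odd (size s).
Proof. by move/perm_size->; rewrite -cardE card_option card_ord /= k_odd. Qed.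

Lemma full_tour d s v : perm_eq s (enum {: slot}) -> v \in tour d s.
Proof. by move=> ps; apply: (@mem_tour _ _ m_le_k); rewrite (perm_mem ps) mem_enum. Qed.

Lemma tour_comb_valid d s : perm_eq s (enum {: slot}) ->
  3 * K + 1 <= cycle_cost (comb_cost H T) hub (tour d s).
Proof.
move=> ps; apply: comb_valid => // [i|i|]; last exact: ltnW.
  by have [v /andP[]] := T_in i; exists v; split=> //; apply: full_tour.
by have [v /andP[]] := T_out i; exists v; split=> //; apply: full_tour.
Qed.

Lemma tour_cut_sum S be d s : near S be -> perm_eq s (enum {: slot}) ->
  cycle_cost (cross S) hub (tour d s) = \sum_i slot_cut S be i.
Proof.
move=> nS ps; rewrite (tour_cut _ nS) ?even_slots ?(perm_uniq ps) ?enum_uniq //.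
by rewrite (perm_big _ ps) big_enum.
Qed.

Hypothesis tight : forall d s, perm_eq s (enum {: slot}) ->
  cycle_cost (comb_cost H T) hub (tour d s) <= 3 * K + 1.

Lemma comb_costC u v : comb_cost H T u v = comb_cost H T v u.
Proof. by rewrite /comb_cost crossC; congr (_ + _); apply: eq_bigr => j _; rewrite crossC. Qed.

(* Exchanging two consecutive paths of a tour trades the connections [i j] and
   [l p] for [i l] and [j p] on one side only. *)
Lemma exchange d i j l p : uniq [:: i; j; l; p] ->
  let c x y := comb_cost H T (endpoint d x) (endpoint d y) in
  c i j + c l p = c i l + c j p.
Proof.
move=> u4 c.
pose rest := [seq x <- enum {: slot} | x \notin [:: i; j; l; p]].
have ps q : perm_eq q [:: i; j; l; p] -> perm_eq (q ++ rest) (enum {: slot}).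
  move=> pq; apply: uniq_perm; rewrite ?enum_uniq //.
    rewrite cat_uniq (perm_uniq pq) u4 filter_uniq ?enum_uniq // andbT /=.
    apply/hasPn => x; rewrite mem_filter => /andP[xn _].
    by apply: contra xn; rewrite (perm_mem pq).
  move=> x; rewrite mem_cat mem_filter mem_enum andbT (perm_mem pq).
  by rewrite inE orbN.
have p1 := ps _ (perm_refl _).
have p2 : perm_eq ([:: i; l; j; p] ++ rest) (enum {: slot}).
  by apply: ps; apply/permP => q /=; lia.
(* Starting with [~~ d] puts the first and third links on side [d]; the link between [j] and [l], on
   the other side, is merely reversed. *)
have eq_cost s : perm_eq s (enum {: slot}) ->
    cycle_cost (comb_cost H T) hub (tour (~~ d) s) = 3 * K + 1.
  by move=> pS; apply/eqP; rewrite eqn_leq tight // tour_comb_valid.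
have := etrans (eq_cost _ p1) (esym (eq_cost _ p2)).
rewrite !(cycle_cost_tour comb_costC) ?even_slots //.
rewrite (perm_big _ p1) (perm_big _ p2) /= => /addnI.
rewrite !negbK /c.
have := comb_costC (endpoint (~~ d) l) (endpoint (~~ d) j) => ->.
by lia.
Qed.

(** In [exchange], tooth [t] favours the pairing [i l], [j p] by 2, and no other tooth opposes this.
    So the handle must compensate by 2, which forces it to agree on [i j] and on [l p] but not on
    [i l]. Swapping [j] and [p] gives agreement on [i p] and [l j], a contradiction. *)
Lemma tooth_no_split d i j l p t : uniq [:: i; j; l; p] ->
  T t (endpoint d i) -> T t (endpoint d l) ->
  ~~ T t (endpoint d j) -> ~~ T t (endpoint d p) -> False.
Proof.
move=> u4 Ti Tl Tj Tp.
have u4' : uniq [:: i; p; l; j].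
  by move: u4; rewrite /= !inE; case: (eqVneq i j); case: (eqVneq i l);
    case: (eqVneq i p); case: (eqVneq j l); rewrite ?(eq_sym p) ?(eq_sym l j) ?(eq_sym j p);
    case: (eqVneq j p); case: (eqVneq l p); case: (eqVneq j l).
have ex1 := exchange d u4; have ex2 := exchange d u4'.
have others a b : ~~ T t (endpoint d a) -> ~~ T t (endpoint d b) ->
    \sum_(q < K | q != t) cross (T q) (endpoint d i) (endpoint d l) +
    \sum_(q < K | q != t) cross (T q) (endpoint d a) (endpoint d b) <=
    \sum_(q < K | q != t) cross (T q) (endpoint d i) (endpoint d a) +
    \sum_(q < K | q != t) cross (T q) (endpoint d l) (endpoint d b).
  move=> Ta Tb; rewrite -!big_split /=; apply: leq_sum => q qt.
  have nq v : T t v -> T q v = false.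
    by move=> Tv; apply/negP => /(T_disjoint Tv) e; rewrite e eqxx in qt.
  by rewrite /cross (nq _ Ti) (nq _ Tl); case: (T q _); case: (T q _).
have o1 := others j p Tj Tp; have o2 := others p j Tp Tj.
move: ex1 ex2; rewrite /comb_cost !(bigD1 (P := xpredT) t) //=.
move: o1 o2.
do 7![move: (\sum_(q < K | q != t) _)=> ?].
rewrite {others}/cross Ti Tl (negbTE Tj) (negbTE Tp).
by case: (H _); case: (H _); case: (H _); case: (H _) => /=; lia.
Qed.

(** The handle favours the pairing [i l], [j p] by 2. By parity a tooth could compensate only by
    separating [i j] from [l p], which [tooth_no_split] excludes. *)
Lemma handle_no_split d i j l p : uniq [:: i; j; l; p] ->
  H (endpoint d i) -> H (endpoint d l) ->
  ~~ H (endpoint d j) -> ~~ H (endpoint d p) -> False.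
Proof.
move=> u4 Hi Hl Hj Hp; have := exchange d u4; rewrite /comb_cost.
have : \sum_(q < K) cross (T q) (endpoint d i) (endpoint d l) +
    \sum_(q < K) cross (T q) (endpoint d j) (endpoint d p) <=
    \sum_(q < K) cross (T q) (endpoint d i) (endpoint d j) +
    \sum_(q < K) cross (T q) (endpoint d l) (endpoint d p).
  rewrite -!big_split /=; apply: leq_sum => q _; rewrite leqNgt; apply/negP.
  have u1 : uniq [:: i; l; j; p].
    by move: u4; rewrite /= !inE; case: (eqVneq i j); case: (eqVneq i l);
      case: (eqVneq i p); rewrite (eq_sym l j); case: (eqVneq j l);
      case: (eqVneq j p); case: (eqVneq l p).
  have u2 : uniq [:: l; i; p; j].
    by move: u4; rewrite /= !inE; rewrite (eq_sym l i) (eq_sym l j) (eq_sym p j);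
      case: (eqVneq i j); case: (eqVneq i l);
      case: (eqVneq i p); case: (eqVneq j l);
      case: (eqVneq j p); case: (eqVneq l p).
  have s1 := @tooth_no_split d i l j p q u1.
  have s2 := @tooth_no_split d l i p j q u2.
  move: s1 s2; rewrite /cross.
  by case: (T q (endpoint d i)); case: (T q (endpoint d j));
    case: (T q (endpoint d l)); case: (T q (endpoint d p)) => //= s1 s2 _; auto.
do 4![move: (\sum_(q < K) _)=> ?].
rewrite /cross Hi Hl (negbTE Hj) (negbTE Hp) /=; lia.
Qed.

(** If [S] contains two ends of a side, it misses at most one end there; otherwise it contains at
    most one. *)
Lemma nearI (S : V -> bool) :
  (forall d i j l p, uniq [:: i; j; l; p] -> S (endpoint d i) -> S (endpoint d l) ->
     ~~ S (endpoint d j) -> ~~ S (endpoint d p) -> False) ->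
  exists be, near S be.
Proof.
move=> ns.
pose be d := [exists i, exists l, [&& i != l, S (endpoint d i) & S (endpoint d l)]].
exists be => d i j ij; rewrite /be; case: existsP => [[a /existsP[b /and3P[ab Sa Sb]]]|no].
  apply/orP; rewrite !eqb_id; apply/orP; apply: contraT; rewrite negb_or => /andP[Si Sj].
  case: (ns d a i b j) => //.
  rewrite /= !inE !negb_or ab ij (_ : a != i) 1?(_ : a != j) 1?(_ : i != b) 1?(_ : b != j) //.
  - by apply: contraNneq Sj => <-.
  - by apply: contraNneq Si => ->.
  - by apply: contraNneq Sj => <-.
  - by apply: contraNneq Si => <-.
rewrite !eqbF_neg -negb_and; apply/negP => /andP[Si Sj]; apply: no.
by exists i; apply/existsP; exists j; rewrite ij Si.
Qed.

Definition single j i := [forall v, T j v ==> (sl v == i)].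

Lemma tooth_two j : exists u v, [/\ T j u, T j v, H u & ~~ H v].
Proof.
have [u /andP[Tu Hu]] := T_in j; have [v /andP[Tv Hv]] := T_out j.
by exists u, v.
Qed.

(** Each tooth has a vertex in the handle and one outside, so two teeth have four vertices, while a
    path has at most three. *)
Lemma single_uniq j j' i : single j i -> single j' i -> j = j'.
Proof.
move=> /forallP sj /forallP sj'; apply/eqP; apply: contraT => jj'.
have [u [v [Tu Tv Hu Hv]]] := tooth_two j.
have [u' [v' [Tu' Tv' Hu' Hv']]] := tooth_two j'.
have ne w w' : T j w -> T j' w' -> w != w'.
  by move=> Tw Tw'; apply: contraNneq jj' => e; rewrite -e in Tw'; rewrite (T_disjoint Tw Tw').
have neH w w' : H w -> ~~ H w' -> w != w' by move=> Hw; apply: contraNneq => <-.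
have := @card_slot_le3 k m m_le_k i [:: u; v; u'; v'].
rewrite /= !inE !negb_or (neH u v) // (neH u' v') // !(ne u) // !(ne v) //.
have -> : sl u == i by have := sj u; rewrite Tu.
have -> : sl v == i by have := sj v; rewrite Tv.
have -> : sl u' == i by have := sj' u'; rewrite Tu'.
have -> : sl v' == i by have := sj' v'; rewrite Tv'.
by move=> /(_ isT isT).
Qed.

Lemma single_slot j i i' : single j i -> single j i' -> i = i'.
Proof.
have [v /andP[Tv _]] := T_in j.
by move=> /forallP/(_ v)/implyP/(_ Tv)/eqP <- /forallP/(_ v)/implyP/(_ Tv)/eqP.
Qed.

Lemma sum_single_teeth (P : pred 'I_K) i : \sum_(j | P j) single j i <= 1.
Proof.
have [/existsP[j0 /andP[Pj0 s0]]|/existsPn no] := boolP [exists j, P j && single j i].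
  rewrite (bigD1 j0) //= s0 big1 // => j /andP[_ jj0].
  by case: (boolP (single j i)) => // sj; rewrite (single_uniq sj s0) eqxx in jj0.
rewrite big1 // => j Pj; have := no j; rewrite Pj /=.
by case: (single j i).
Qed.

Lemma sum_single_slots j : \sum_i single j i <= 1.
Proof.
have [/existsP[i0 s0]|/existsPn no] := boolP [exists i, single j i].
  rewrite (bigD1 i0) //= s0 big1 // => i ii0.
  by case: (boolP (single j i)) => // si; rewrite (single_slot si s0) eqxx in ii0.
by rewrite big1 // => i _; rewrite (negbTE (no i)).
Qed.

Lemma single_None j : single j None = false.
Proof.
apply/negP => /forallP s; have [u [v [Tu Tv Hu Hv]]] := tooth_two j.
have := s u; have := s v; rewrite Tu Tv /=.
case: v Hv {s Tv} => [[[?|?]|?]|] //; case: u Hu {Tu} => [[[?|?]|?]|] // -> //.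
Qed.

(** Each path that meets [T j] contributes at least 2 to the cut, and a tooth not inside a single
    path meets two of them. *)
Lemma spread_cut j (S : V -> bool) be : be true = be false ->
  (forall v, T j v -> S v != be true) ->
  4 <= \sum_i slot_cut S be i + 2 * \sum_i single j i.
Proof.
move=> ebe TS; have [v /andP[Tv _]] := T_in j.
have c1 := slot_cut_ge2 m_le_k ebe (TS v Tv).
have [s|] := boolP (single j (sl v)).
  by rewrite (bigD1 (sl v)) //= [X in 2 * X](bigD1 (sl v)) //= s; lia.
rewrite negb_forall => /existsP[w]; rewrite negb_imply => /andP[Tw wv].
have c2 := slot_cut_ge2 m_le_k ebe (TS w Tw).
by rewrite (bigD1 (sl v)) //= (bigD1 (sl w)) //=; lia.
Qed.

Lemma spread_cut_sum (P : pred 'I_K) :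
  (forall j, P j -> near (T j) (fun=> false)) ->
  4 * \sum_(j | P j) 1 <=
  \sum_(j | P j) \sum_i slot_cut (T j) (fun=> false) i +
  2 * \sum_i \sum_(j | P j) single j i.
Proof.
move=> nP; rewrite [X in 2 * X]exchange_big !big_distrr /= -big_split /=; apply: leq_sum => j Pj.
by rewrite muln1; apply: spread_cut => // v ->.
Qed.

(** A path containing a tooth has vertices inside and outside the handle, so one of them deviates
    from [be true]. *)
Lemma handle_even_cut be (P : pred 'I_K) i : be true = be false ->
  2 * \sum_(j | P j) single j i <= slot_cut H be i.
Proof.
move=> ebe; have := sum_single_teeth P i; case e : (\sum_(j | P j) _) => [|[|//]] // _.
have [/existsP[j /andP[Pj /forallP sj]]|/existsPn no] := boolP [exists j, P j && single j i].
  have [u [v [Tu Tv Hu Hv]]] := tooth_two j.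
  have := sj u; have := sj v; rewrite Tu Tv /= => /eqP iv /eqP iu.
  case eb : (be true); first by rewrite -iv; apply: slot_cut_ge2 => //; rewrite eb eqb_id.
  by rewrite -iu; apply: slot_cut_ge2 => //; rewrite eb Hu.
move: e; rewrite big1 // => j Pj; have := no j; rewrite Pj /=.
by case: (single j i).
Qed.

Lemma handle_odd_cut be : be true != be false -> k.+1 <= \sum_i slot_cut H be i.
Proof.
move=> nbe; have -> : k.+1 = \sum_(i : slot) 1.
  by rewrite sum1_card card_option card_ord.
by apply: leq_sum => i _; apply: slot_cut_ge1.
Qed.

Let s0 := enum {: slot}.
Let p0 : perm_eq s0 (enum {: slot}) := perm_refl _.

Lemma comb_total : cycle_cost (cross H) hub (tour true s0) +
  \sum_j cycle_cost (cross (T j)) hub (tour true s0) = 3 * K + 1.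
Proof.
by rewrite -cycle_comb_cost; apply/eqP; rewrite eqn_leq tight // tour_comb_valid.
Qed.

Lemma tooth_cut_bounds j : 2 <= cycle_cost (cross (T j)) hub (tour true s0) <= 4.
Proof.
have tin i : exists v, [/\ v \in tour true s0, T i v & H v].
  by have [v /andP[]] := T_in i; exists v; split=> //; apply: full_tour.
have tout i : exists v, [/\ v \in tour true s0, T i v & ~~ H v].
  by have [v /andP[]] := T_out i; exists v; split=> //; apply: full_tour.
apply/andP; split; first exact: (tooth_cut_ge2 _ T_disjoint tin (ltnW K_gt2)).
by apply: (tight_tooth_le4 T_disjoint tin tout (ltnW K_gt2)); apply: tight.
Qed.

Lemma sum_ord_neq (t : 'I_K) : \sum_(j | j != t) 1 = K.-1.
Proof. by rewrite sum1_card cardC1 card_ord. Qed.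

(** Different values of [be] on the two sides would give a cut of at least [k.+1], above the bound
    4. If instead [T t] contained almost all ends, the comb would cost more than [3 * K + 1]. *)
Lemma tooth_small t : near (T t) (fun=> false).
Proof.
have [be nT] : exists be, near (T t) be.
  by apply: nearI => d i j l p u4; apply: tooth_no_split.
have [b2 b4] := andP (tooth_cut_bounds t).
have eT := tour_cut_sum true nT p0.
have [ebe|nbe] := eqVneq (be true) (be false); last first.
  have : k.+1 <= \sum_i slot_cut (T t) be i.
    have -> : k.+1 = \sum_(i : slot) 1 by rewrite sum1_card card_option card_ord.
    by apply: leq_sum => i _; apply: slot_cut_ge1.
  by move: eT b4 => ->; lia.
case bt : (be true); last first.
  by move=> d i j ij; have := nT d i j ij; case: d; rewrite -?ebe bt.
(* From here on [T t] misses at most one end on each side; the other teeth avoid it and are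
   therefore small. *)
have nTt v j : j != t -> T j v -> T t v = false.
  by move=> jt Tv; apply/negP => /(T_disjoint Tv) e; rewrite e eqxx in jt.
have nJ j : j != t -> near (T j) (fun=> false).
  move=> jt d i i' ii'; rewrite !eqbF_neg -negb_and; apply/negP => /andP[Ti Ti'].
  have := nT d i i' ii'; rewrite (nTt _ j jt Ti) (nTt _ j jt Ti').
  by case: d {Ti Ti'}; rewrite -?ebe bt.
have Jcut j : j != t -> 4 <= \sum_i slot_cut (T t) be i + 2 * \sum_i single j i.
  by move=> jt; apply: spread_cut => // v /(nTt _ _ jt) ->; rewrite bt.
have Jsum := spread_cut_sum nJ; rewrite sum_ord_neq in Jsum.
have qT : 2 * \sum_i \sum_(j | j != t) single j i <= \sum_i slot_cut (T t) be i.
  rewrite big_distrr /=; apply: leq_sum => i _.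
  have := sum_single_teeth (fun j => j != t) i.
  case e : (\sum_(j | j != t) _) => [|[|//]] // _.
  have [/existsP[j /andP[jt /forallP sj]]|/existsPn no] :=
      boolP [exists j, (j != t) && single j i].
    have [v /andP[Tv _]] := T_in j; have := sj v; rewrite Tv /= => /eqP <-.
    by apply: slot_cut_ge2; rewrite // bt (nTt _ _ jt Tv).
  move: e; rewrite big1 // => j jt; have := no j; rewrite jt /=.
  by case: (single j i).
have [bh nH] : exists be, near H be.
  by apply: nearI => d i j l p u4; apply: handle_no_split.
have tot := comb_total; rewrite (tour_cut_sum true nH p0) (bigD1 t) //= eT in tot.
rewrite (eq_bigr _ (fun j jt => tour_cut_sum true (nJ j jt) p0)) in tot.
rewrite eT in b2 b4.
(* Let [q] of the other teeth lie inside paths. The others cost at least [4 * K.-1 - 2 * q]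
   together, and [T t] at least [2 * q]. If [bh] is not constant, the handle adds at least 6, which
   is too much. *)
have [ebh|nbh] := eqVneq (bh true) (bh false); last first.
  have := handle_odd_cut nbh; move: tot Jsum qT.
  move: (\sum_i slot_cut H bh i) (\sum_i slot_cut (T t) be i) => x y.
  move: (\sum_i \sum_(j | _) _) (\sum_(j | _) \sum_i _) => z w; lia.
have qH : 2 * \sum_i \sum_(j | j != t) single j i <= \sum_i slot_cut H bh i.
  by rewrite big_distrr /=; apply: leq_sum => i _; apply: handle_even_cut.
(* If [bh] is constant, the handle costs at least [2 * q], so a cut of [T t] above 2 is too much. If
   that cut is 2, all [K.-1] other teeth lie inside paths, and these make it at least [2 * K.-1], a
   contradiction. *)
have all1 : \sum_i slot_cut (T t) be i <= 2 -> K.-1 <= \sum_i \sum_(j | j != t) single j i.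
  move=> le2; rewrite exchange_big /= -(sum_ord_neq t); apply: leq_sum => j jt.
  have := Jcut j jt; move: le2; move: (\sum_i slot_cut _ _ _) (\sum_i nat_of_bool _) => x y.
  by lia.
move: tot Jsum qT qH all1 b2 b4.
move: (\sum_i slot_cut H bh i) (\sum_i slot_cut (T t) be i) => x y.
move: (\sum_i \sum_(j | _) _) (\sum_(j | _) \sum_i _) => z w; lia.
Qed.

(** Let [q] be the number of teeth inside paths; it is at most [k] and at most [K]. The teeth cost
    at least [4 * K - 2 * q]. If [be] is constant, the handle costs at least [2 * q], too much in
    total. Otherwise it costs at least [k.+1], and the total [3 * K + 1] forces [q = k = K] and
    exactly one handle crossing per path. *)
Theorem tight_comb_shape :
  (exists b, forall i, H (top_end m i) = b /\ H (bot_end m i) = ~~ b) /\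
  (forall j, exists i, forall v, T j v -> sl v = Some i).
Proof.
have [be nH] : exists be, near H be.
  by apply: nearI => d i j l p u4; apply: handle_no_split.
have tot := comb_total; rewrite (tour_cut_sum true nH p0) in tot.
rewrite (eq_bigr _ (fun j _ => tour_cut_sum true (tooth_small j) p0)) in tot.
have spread := @spread_cut_sum xpredT (fun j _ => tooth_small j).
rewrite sum1_card card_ord in spread.
have [ebe|nbe] := eqVneq (be true) (be false).
  have qH : 2 * \sum_i \sum_j single j i <= \sum_i slot_cut H be i.
    by rewrite big_distrr /=; apply: leq_sum => i _; apply: handle_even_cut.
  move: tot spread qH; move: (\sum_i slot_cut H be i) => x.
  by move: (\sum_i \sum_j nat_of_bool _) (\sum_(j < K) \sum_i _) => y z; lia.
have cutH := handle_odd_cut nbe.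
have qk : \sum_i \sum_j single j i <= k.
  rewrite -[X in _ <= X](card_ord k) -sum1_card sum_option /=.
  rewrite big1 ?add0n; last by move=> j _; rewrite single_None.
  by apply: leq_sum => i _; apply: sum_single_teeth.
have qK : \sum_i \sum_j single j i <= K.
  rewrite exchange_big /= -[X in _ <= X](card_ord K) -sum1_card.
  by apply: leq_sum => j _; apply: sum_single_slots.
have [eqK [eqk eqH]] : K <= \sum_i \sum_j single j i /\
    (k <= \sum_i \sum_j single j i /\ \sum_i slot_cut H be i <= k.+1).
  move: tot spread cutH qk qK.
  move: (\sum_i slot_cut H be i) => x.
  by move: (\sum_i \sum_j nat_of_bool _) (\sum_(j < K) \sum_i _) => y z; lia.
have sj j : \sum_i single j i = 1.
  apply: (@sum_le_eq _ (fun j => \sum_i single j i) (fun=> 1)) => {j} [j|].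
    exact: sum_single_slots.
  by rewrite sum1_card card_ord; move: eqK; rewrite exchange_big.
have hi i : 1 = slot_cut H be i.
  apply: (@sum_le_eq _ (fun=> 1) (slot_cut H be)) => {i} [i|].
    exact: slot_cut_ge1.
  by rewrite sum1_card card_option card_ord.
have qi (i : 'I_k) : \sum_j single j (Some i) = 1.
  apply: (@sum_le_eq _ (fun i : 'I_k => \sum_j single j (Some i)) (fun=> 1)) => {i} [i|].
    exact: sum_single_teeth.
  rewrite sum1_card card_ord; move: eqk; rewrite sum_option /=.
  by rewrite big1 ?add0n // => j _; rewrite single_None.
split.
  exists (be true) => i.
  have [j /forallP sji] : exists j, single j (Some i).
    apply/existsP; apply: contraT => /existsPn no.
    by have := qi i; rewrite big1 // => j _; rewrite (negbTE (no j)).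
  have [u [v [Tu Tv Hu Hv]]] := tooth_two j.
  have := sji u; have := sji v; rewrite Tu Tv /= => /eqP iv /eqP iu.
  (* The tooth inside this path meets both sides of the handle, so the only crossing is an inner
     edge and both ends have the prescribed values. *)
  have := @path_cost_cross_gt0 k m m_le_k H u v (etrans iu (esym iv)).
  rewrite Hu eq_sym eqb_id Hv iu => /(_ isT).
  have := hi (Some i); rewrite /slot_cut /=.
  move: nbe; case: (H (top_end _ _)); case: (H (bot_end _ _)); case: (be true);
    case: (be false) => //=; lia.
move=> j.
have [i si] : exists i, single j i.
  apply/existsP; apply: contraT => /existsPn no.
  by have := sj j; rewrite big1 // => i _; rewrite (negbTE (no i)).
case: i si => [i|]; last by rewrite single_None.
by move=> /forallP si; exists i => v Tv; have := si v; rewrite Tv => /eqP.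
Qed.

End TightCombs.

(** * Tightness of the combs belonging to subsets *)

Section TightCuts.
Variables (k m : nat) (m_le_k : m <= k).
Notation V := (vertex k m).
Notation slot := (slot k).
Notation sl := (slot_of m_le_k).
Notation endpoint := (@endpoint k m).

Lemma slot_of_endpoint d i : sl (endpoint d i) = i.
Proof. by case: i => [i|] //; case: d. Qed.

Lemma near_at_most_one (S : V -> bool) :
  (forall u v, S u -> S v -> sl u = sl v) -> near S (fun=> false).
Proof.
move=> S1 d i j ij; rewrite !eqbF_neg -negb_and; apply/negP => /andP[Si Sj].
by have := S1 _ _ Si Sj; rewrite !slot_of_endpoint => e; rewrite e eqxx in ij.
Qed.

Lemma slot_cut_path (i i' : slot) :
  slot_cut (fun v : V => sl v == i) (fun=> false) i' = 2 * (i' == i).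
Proof.
have -> : slot_cut (fun v : V => sl v == i) (fun=> false) i' =
          (i' == i) + path_cost (cross (fun v : V => sl v == i)) i' + (i' == i).
  by rewrite /slot_cut !slot_of_endpoint; case: (i' == i).
suff -> : path_cost (cross (fun v : V => sl v == i)) i' = 0 by lia.
rewrite /path_cost; case: i' => [i'|] /=; last by rewrite walk_cost_nil.
case: (middleP m i') => [->|[j ij ->]] /=.
  by rewrite walk_cost_cons walk_cost_nil /cross /= addbb.
have e : widen_ord m_le_k j = i' by apply: val_inj.
by rewrite !walk_cost_cons walk_cost_nil /cross /= e addbb.
Qed.

Lemma vertex_eqE :
  [/\ forall i i' : 'I_k, (top_end m i == top_end m i') = (i == i'),
      forall i i' : 'I_k, (bot_end m i == bot_end m i') = (i == i') &
      forall j j' : 'I_m, (mid k j == mid k j' :> V) = (j == j')].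
Proof. by split=> ? ?; apply/eqP/eqP => [[->]|->]. Qed.

Lemma slot_cut_vertex (v : V) i :
  slot_cut (fun u => u == v) (fun=> false) i = 2 * (i == sl v).
Proof.
have [topE bottomE midE] := vertex_eqE.
rewrite /slot_cut /path_cost; case: i => [i|] /=; last first.
  by rewrite walk_cost_nil; case: v => [[[?|?]|?]|].
have slotE i' : (Some i == Some i' :> slot) = (i == i') by apply/eqP/eqP => [[->]|->].
have path_costE : walk_cost (cross (eq_op^~ v)) (top_end m i) (rcons (middle m i) (bot_end m i))
    = (if v is Some (inr j) then 2 * (i == widen_ord m_le_k j)
       else (top_end m i == v) || (bot_end m i == v) : nat).
  case: (middleP m i) => [e|[j ij e]]; rewrite e /= !walk_cost_cons walk_cost_nil /cross.
    case: v => [[[i'|i']|j']|] //=.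
    - by rewrite -/(top_end m i') topE; case: (i == i').
    - by rewrite -/(bot_end m i') bottomE; case: (i == i').
    by case: eqP => // ij'; move: e; rewrite ij' (middle_widen (m_le_k := m_le_k) erefl).
  have ei : i = widen_ord m_le_k j by apply: val_inj.
  case: v => [[[i'|i']|j']|] //=.
  - by rewrite -/(top_end m i') topE; case: (i == i').
  - by rewrite -/(bot_end m i') bottomE; case: (i == i').
  have -> : (i == widen_ord m_le_k j') = (j == j').
    by rewrite ei; apply/eqP/eqP => [[e']|->//]; apply: val_inj.
  by rewrite -/(mid k j') midE; case: (j == j').
rewrite path_costE; case: v {path_costE} => [[[i'|i']|j']|] //=.
- by rewrite -/(top_end m i') topE slotE; case: (i == i').
- by rewrite -/(bot_end m i') bottomE slotE; case: (i == i').
by rewrite slotE addn0.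
Qed.

Definition handle (y : seq bool) (v : V) : bool :=
  match v with
  | Some (inl (inr _)) => false
  | Some (inr j) => nth false y j
  | _ => true
  end.

Lemma near_handle y : near (handle y) id.
Proof. by move=> [] [i|] [j|]. Qed.

(** A path crosses once between its top and its bottom end, before or after a possible middle
    vertex; the hub is exceptional on the bottom side only. *)
Lemma slot_cut_handle y i : slot_cut (handle y) id i = 1.
Proof.
rewrite /slot_cut /path_cost; case: i => [i|] /=; last by rewrite walk_cost_nil.
case: (middleP m i) => [->|[j ij ->]] /=; rewrite !walk_cost_cons walk_cost_nil /cross //=.
by case: (nth _ _ _).
Qed.

Hypothesis k_odd : odd k.

Lemma tour_vertex_cut v d s : perm_eq s (enum {: slot}) ->
  cycle_cost (cross (fun u : V => u == v)) (hub k m) (tour m d s) = 2.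
Proof.
move=> ps; rewrite (@tour_cut_sum _ _ k_odd _ (fun=> false)) //; last first.
  by apply: near_at_most_one => u w /eqP-> /eqP->.
rewrite (bigD1 (sl v)) //= slot_cut_vertex eqxx big1 // => i iv.
by rewrite slot_cut_vertex (negbTE iv).
Qed.

Lemma tour_handle_tight y d s : perm_eq s (enum {: slot}) ->
  cycle_cost (comb_cost (handle y) (fun (i : 'I_k) v => sl v == Some i))
    (hub k m) (tour m d s) = 3 * k + 1.
Proof.
move=> ps; rewrite cycle_comb_cost (tour_cut_sum k_odd _ (near_handle y)) //.
rewrite (eq_bigr _ (fun i _ => slot_cut_handle y i)) sum1_card card_option card_ord.
rewrite (eq_bigr (fun=> 2)) => [|i _].
  by rewrite sum_nat_const card_ord; lia.
rewrite (@tour_cut_sum _ _ k_odd _ (fun=> false)) //; last first.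
  by apply: near_at_most_one => u w /eqP-> /eqP->.
rewrite (bigD1 (Some i)) //= slot_cut_path eqxx big1 // => i' ii'.
by rewrite slot_cut_path (negbTE ii').
Qed.

End TightCuts.

Import Order.TTheory GRing.Theory Num.Theory.
Local Open Scope classical_set_scope.
Local Open Scope ring_scope.
Local Open Scope card_scope.
Local Notation cut := Defs.cut.

(** * Facets of polyhedra *)

(** Provides a step short enough to preserve finitely many strict inequalities. *)
Lemma common_scaling (R : realType) (I : eqType) (s : seq I) (p q : I -> R) :
  (forall i, i \in s -> 0 < p i) ->
  exists2 t, 0 < t & forall i, i \in s -> t * q i <= p i.
Proof.
elim: s => [|i s IH] ps; first by exists 1.
have [j js|t t0 ts] := IH; first by apply: ps; rewrite inE js orbT.
have pi0 : 0 < p i by apply: ps; rewrite mem_head.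
have q1 : 0 < `|q i| + 1 by rewrite ltr_wpDl.
exists (Num.min t (p i / (`|q i| + 1))); first by rewrite lt_min t0 divr_gt0.
set u := Num.min _ _; have u0 : 0 < u by rewrite lt_min t0 divr_gt0.
have ut : u <= t by rewrite ge_min lexx.
have up : u * (`|q i| + 1) <= p i by rewrite -ler_pdivlMr // ge_min lexx orbT.
move=> j; rewrite inE => /orP[/eqP->|js].
  apply: le_trans up; rewrite ler_pM2l //.
  by apply: le_trans (ler_norm _) _; rewrite lerDl.
have [q0|q0] := leP 0 (q j); first by apply: le_trans (ts j js); rewrite ler_wpM2r.
apply: le_trans (ltW (ps j _)); last by rewrite inE js orbT.
by rewrite pmulr_rle0 // ltW.
Qed.

Lemma mulmx_line (R : realType) d k (A : 'M[R]_(d, k)) (y z : 'rV[R]_d) (t : R) j :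
  ((y + t *: (z - y)) *m A) 0 j = (1 - t) * (y *m A) 0 j + t * (z *m A) 0 j.
Proof. by rewrite mulmxDl -scalemxAl mulmxBl !mxE; ring. Qed.

Section Polyhedra.
Variables (R : realType) (d k : nat) (A : 'M[R]_(d, k)) (b : 'rV[R]_k).
Implicit Types (y z : 'rV[R]_d) (Q F G : set 'rV[R]_d) (K E : {set 'I_k}).

Definition row_slack j y : R := b 0 j - (y *m A) 0 j.

Lemma row_slack_line j y z (t : R) :
  row_slack j (y + t *: (z - y)) = (1 - t) * row_slack j y + t * row_slack j z.
Proof. by rewrite /row_slack mulmx_line; ring. Qed.

(** Rows in [E] are imposed as equations, so that [K] can be thinned out to an irredundant set of
    inequalities. *)
Definition row_system K E : set 'rV[R]_d :=
  [set y | (forall j, j \in K -> 0 <= row_slack j y) /\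
           (forall j, j \in E -> row_slack j y = 0)].

Lemma row_system_line K E y z (t : R) : 0 <= t <= 1 ->
  row_system K E y -> row_system K E z -> row_system K E (y + t *: (z - y)).
Proof.
move=> t01 [yK yE] [zK zE]; split=> j jK; rewrite row_slack_line.
  by have := yK j jK; have := zK j jK; nra.
by rewrite yE // zE // !mulr0 addr0.
Qed.

Lemma face_line Q F y z (t : R) : 0 <= t <= 1 ->
  (forall u v, Q u -> Q v -> Q (u + t *: (v - u))) ->
  face Q F -> F y -> F z -> F (y + t *: (z - y)).
Proof.
move=> t01 Qc [_ [a [beta [_ ->]]]] [Qy ey] [Qz ez]; split; first exact: Qc.
by rewrite mulmx_line ey ez; ring.
Qed.

(** The midpoint of two points of [C] is strict in every row in which one of them is. *)
Lemma strict_point (C : set 'rV[R]_d) (s : seq 'I_k) :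
  (forall u v, C u -> C v -> C (u + 2^-1 *: (v - u))) ->
  (forall j u, j \in s -> C u -> 0 <= row_slack j u) ->
  C !=set0 -> (forall j, j \in s -> exists2 u, C u & row_slack j u != 0) ->
  exists2 u, C u & forall j, j \in s -> 0 < row_slack j u.
Proof.
move=> Cc Cs [u0 Cu0]; elim: s Cs => [|j s IH] Cs ex; first by exists u0.
have [||u Cu us] := IH.
- by move=> i u si; apply: Cs; rewrite inE si orbT.
- by move=> i si; apply: ex; rewrite inE si orbT.
have [v Cv vj] := ex j (mem_head _ _).
exists (u + 2^-1 *: (v - u)) => [|i]; first exact: Cc.
have := Cs i u; have := Cs i v; rewrite inE row_slack_line.
case: eqP => [-> /= |_ /= vs us' si].
  move=> /(_ isT Cv) v0 /(_ isT Cu) u0' _.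
  have : 0 < row_slack j v by rewrite lt_neqAle eq_sym vj.
  by lra.
by have := vs si Cv; have := us i si; lra.
Qed.

(* If [y] is tight wherever all of [F] is, then a point of [F] strict elsewhere
   can be moved slightly away from [y] inside [Q]. *)
Lemma face_determined K E F y : let Q := row_system K E in
  face Q F -> Q y ->
  (forall j, j \in K -> (forall z, F z -> row_slack j z = 0) ->
     row_slack j y = 0) -> F y.
Proof.
move=> Q fF Qy tight.
have [F0 [a [beta [aQ eF]]]] := fF.
have FQ : F `<=` Q by rewrite eF => z [].
pose loose := [pred j | (j \in K) && `[< exists2 u, F u & row_slack j u != 0 >]].
have half : 0 <= (2^-1 : R) <= 1 by lra.
have [|||j|z Fz zs] := @strict_point F (enum loose).
- by move=> u v; apply: (@face_line Q) => // u' v'; apply: row_system_line.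
- by move=> j u; rewrite mem_enum inE => /andP[jK _] /FQ[+ _]; apply.
- exact: F0.
- by rewrite mem_enum inE => /andP[_ /asboolP].
have [j|t t0 ts] := @common_scaling R _ (enum loose) (row_slack^~ z) (row_slack^~ y).
  exact: zs.
have Qz := FQ _ Fz.
have Qw : Q (z + (- t) *: (y - z)).
  split=> j jK; rewrite row_slack_line; last first.
    by rewrite (Qz.2 _ jK) (Qy.2 _ jK) !mulr0 addr0.
  have [jl|jl] := boolP (j \in enum loose).
    by have := ts _ jl; have := zs _ jl; nra.
  have jF : forall u, F u -> row_slack j u = 0.
    move=> u Fu; apply/eqP; apply: contraNT jl => u0.
    by rewrite mem_enum inE jK; apply/asboolP; exists u.
  by rewrite (jF _ Fz) (tight j jK jF) !mulr0 addr0.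
have ez : (z *m a) 0 0 = beta by move: Fz; rewrite eF => -[].
have := aQ _ Qw; rewrite mulmx_line ez => le1.
have le2 := aQ _ Qy; rewrite eF; split=> //.
apply/eqP; rewrite eq_le le2 /= -subr_le0.
have : t * (beta - (y *m a) 0 0) <= 0 by move: le1; lra.
by rewrite pmulr_rle0.
Qed.

(** By [face_determined], a face is recovered from the set of rows tight on all of it. *)
Lemma row_system_faces_finite K E : finite_set [set F | face (row_system K E) F].
Proof.
set Q := row_system K E.
pose f (J : {set 'I_k}) := [set y | Q y /\ forall j, j \in J -> row_slack j y = 0].
apply: (@sub_finite_set _ _ (f @` setT)); last exact/finite_image/finite_finset.
move=> F fF; exists [set j in K | `[< forall z, F z -> row_slack j z = 0 >]]%SET => //.
have FQ : F `<=` Q by case: fF => _ [a [beta [_ ->]]] z [].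
apply/seteqP; split=> y /=.
  move=> [Qy tight]; apply: (face_determined fF Qy) => j jK jF; apply: tight.
  by rewrite !inE jK; apply/asboolP.
by move=> Fy; split; [exact: FQ|move=> j; rewrite !inE => /andP[_ /asboolP]; apply].
Qed.

Lemma row_face Q j : (forall y, Q y -> 0 <= row_slack j y) ->
  [set y | Q y /\ row_slack j y = 0] !=set0 ->
  face Q [set y | Q y /\ row_slack j y = 0].
Proof.
move=> Qj ne; split=> //; exists (col j A), (b 0 j).
have e y : (y *m col j A) 0 0 = (y *m A) 0 j.
  by rewrite !mxE; apply: eq_bigr => i _; rewrite mxE.
split=> [y /Qj|]; first by rewrite e subr_ge0.
apply/seteqP; split=> y /= [Qy]; rewrite e => /eqP h; split=> //; apply/eqP.
  by rewrite -subr_eq0 -oppr_eq0 opprB.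
by rewrite subr_eq0 eq_sym.
Qed.

(** With the implicit equations [E] and a smallest set [K] of inequalities describing [Q], each row
    of [K] cuts out a facet. By [face_determined], some row of [K] is tight on [F] but not at
    [y]. *)
Lemma row_facet_separates F y : let Q := row_system [set: 'I_k] finset.set0 in
  face Q F -> Q y -> ~ F y -> exists G, [/\ facet Q G, F `<=` G & ~ G y].
Proof.
move=> Q fF Qy nFy.
pose E := [set j | `[< forall z, Q z -> row_slack j z = 0 >]]%SET.
pose pres (K : {set 'I_k}) := `[< Q = row_system K E >].
have presT : pres finset.setT.
  apply/asboolP/seteqP; split=> z [zK zE]; split=> // j; rewrite inE //.
  by move/asboolP; apply; split=> // i; rewrite inE.
have [K /asboolP QK Kmin] := arg_minnP (fun K : {set 'I_k} => #|K|) presT.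
(* As [K] is smallest, dropping row [j] admits a point that violates only this row of [K]. *)
have out j : j \in K -> exists z,
    [/\ row_slack j z < 0, forall i, i \in K -> i != j -> 0 <= row_slack i z &
        forall i, i \in E -> row_slack i z = 0].
  move=> jK; have : ~ pres (K :\ j)%SET.
    by move/Kmin; rewrite [#|K|](cardsD1 j) jK ltnn.
  move=> npres; apply: contrapT => nz; apply: npres; apply/asboolP.
  rewrite QK; apply/seteqP; split=> z [zK zE]; split=> // i.
    by rewrite !inE => /andP[_]; apply: zK.
  move=> iK; have [->|ij] := eqVneq i j; last by apply: zK; rewrite !inE ij.
  rewrite leNgt; apply/negP => lt0; apply: nz; exists z; split=> // l lK lj.
  by apply: zK; rewrite !inE lj.
have KE j : j \in K -> exists2 z, Q z & row_slack j z != 0.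
  move=> jK; have [z [z0 zK zE]] := out j jK; apply: contrapT => nz.
  suff jE : j \in E by have := zE j jE; move: z0 => /[swap] ->; rewrite ltxx.
  rewrite inE; apply/asboolP => u Qu; apply/eqP; apply: contrapT => /negP u0.
  by apply: nz; exists u.
have half : 0 <= (2^-1 : R) <= 1 by lra.
have [|||j|z Qz zs] := @strict_point Q (enum K).
- by move=> u v; apply: row_system_line.
- by move=> j u _ [+ _]; apply; rewrite inE.
- by exists y.
- by rewrite mem_enum; apply: KE.
have fF' : face (row_system K E) F by rewrite -QK.
have Qy' : row_system K E y by rewrite -QK.
have [j [jK jF yj]] : exists j, [/\ j \in K,
    forall z, F z -> row_slack j z = 0 & row_slack j y != 0].
  apply: contrapT => nj; apply: nFy; apply: (face_determined fF' Qy') => j jK jF.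
  by apply/eqP; apply: contrapT => /negP yj; apply: nj; exists j.
exists [set u | Q u /\ row_slack j u = 0].
have FQ : F `<=` Q by case: fF => _ [a [beta [_ ->]]] u [].
have FG : F `<=` [set u | Q u /\ row_slack j u = 0].
  by move=> u Fu; split; [exact: FQ|exact: jF].
have nGy : ~ [set u | Q u /\ row_slack j u = 0] y by case=> _ /eqP; apply/negP.
split=> //; split.
- apply: row_face => [u [+ _]|]; first by apply; rewrite inE.
  by case: fF => -[u Fu] _; exists u; apply: FG.
- by move=> GQ; apply: nGy; rewrite GQ.
move=> G fG subG GQ.
(* The segment from the strict point [z] to [z'] contains a point [w] of [Q] with zero slack in row
   [j] and positive slack in all other rows of [K]. Hence [j] is the only row of [K] that can be
   tight on all of [G]. *)
have [z' [z'0 z'K z'E]] := out j jK.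
have zj : 0 < row_slack j z by apply: zs; rewrite mem_enum.
pose den := row_slack j z - row_slack j z'.
have den0 : 0 < den by rewrite subr_gt0 (lt_trans z'0).
pose t := row_slack j z / den.
have t0 : 0 < t by rewrite divr_gt0.
have t1 : t < 1 by rewrite ltr_pdivrMr // mul1r /den; lra.
have et : t * den = row_slack j z by rewrite divfK // gt_eqF.
pose w := z + t *: (z' - z).
have wj : row_slack j w = 0 by rewrite row_slack_line; move: et; rewrite /den; lra.
have wi i : i \in K -> i != j -> 0 < row_slack i w.
  move=> iK ij; rewrite row_slack_line.
  by have := z'K i iK ij; have := zs i; rewrite mem_enum iK => /(_ isT); nra.
have Qw : Q w.
  rewrite QK; split=> i iK.
    by have [->|/(wi i iK)/ltW//] := eqVneq i j; rewrite wj.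
  rewrite row_slack_line z'E // mulr0 addr0.
  by move: Qz; rewrite QK => -[_ ->] //; rewrite mulr0.
have Gw : G w by apply: subG.
have GQs : G `<=` Q by case: fG => _ [a [beta [_ ->]]] u [].
have [u [Qu nGu]] : exists u, Q u /\ ~ G u.
  apply: contrapT => nu; apply: GQ; apply/seteqP; split=> // u Qu.
  by apply: contrapT => nG; apply: nu; exists u.
have fG' : face (row_system K E) G by rewrite -QK.
have Qu' : row_system K E u by rewrite -QK.
apply/seteqP; split=> // v Gv; split; first exact: GQs.
have [i [iK iG ui]] : exists i, [/\ i \in K,
    forall z, G z -> row_slack i z = 0 & row_slack i u != 0].
  apply: contrapT => ni; apply: nGu; apply: (face_determined fG' Qu') => i iK iG.
  by apply/eqP; apply: contrapT => /negP ui; apply: ni; exists i.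
have [<-|ij] := eqVneq i j; first exact: iG.
by have := wi i iK ij; rewrite (iG _ Gw) ltxx.
Qed.

End Polyhedra.

Lemma polyhedron_row_system (R : realType) d k (A : 'M[R]_(d, k)) (b : 'rV_k) :
  [set y | forall j, (y *m A) 0 j <= b 0 j] =
  row_system A b [set: 'I_k] finset.set0.
Proof.
apply/seteqP; split=> y /=.
  by move=> yA; split=> j; rewrite inE // subr_ge0.
by move=> [yA _] j; rewrite -subr_ge0 yA // inE.
Qed.

Lemma facet_separates (R : realType) d (Q F : set 'rV[R]_d) y :
  polyhedron Q -> face Q F -> Q y -> ~ F y ->
  exists G, [/\ facet Q G, F `<=` G & ~ G y].
Proof.
by move=> [k [A [b]]]; rewrite polyhedron_row_system => ->; apply: row_facet_separates.
Qed.

Lemma polyhedron_facets_finite (R : realType) d (Q : set 'rV[R]_d) :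
  polyhedron Q -> finite_set [set F | facet Q F].
Proof.
move=> [k [A [b]]]; rewrite polyhedron_row_system => ->.
apply: sub_finite_set (row_system_faces_finite A b finset.setT finset.set0).
by move=> F [].
Qed.

(** * Rectangles from an extension *)

Lemma linear_functional_col (R : realType) d (f : {linear 'rV[R]_d -> R^o}) (y : 'rV[R]_d) :
  (y *m (\col_i f 'e_i)) 0 0 = f y.
Proof.
rewrite [in RHS](row_sum_delta y) linear_sum mxE.
by apply: eq_bigr => i _; rewrite linearZ mxE.
Qed.

(* Facet [j] of the extension yields the rectangle of pairs [(x, y)] such that
   the lift of the point of [x] avoids it while it contains the face of [y]. *)
Lemma extension_disjointness (R : realType) (V : lmodType R) (P : set V) m r
    (pt : bitseq -> V) (l : bitseq -> {linear V -> R^o}) (c : bitseq -> R) :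
  (forall x, size x = m -> P (pt x)) ->
  (forall y v, size y = m -> P v -> c y <= l y v) ->
  (forall x y, size x = m -> size y = m ->
     (l y (pt x) == c y) = (common x y == 1%N)) ->
  has_extension P r -> (3 ^ m <= r.+1 * 2 ^ m)%N.
Proof.
move=> ptP lP slk [d [Q [pi [polQ cardQ piQ]]]].
have [lift lift_ok] : exists lift : bitseq -> 'rV[R]_d,
    forall x, size x = m -> Q (lift x) /\ pi (lift x) = pt x.
  have ex x : exists y, size x = m -> Q y /\ pi y = pt x.
    have [sx|sx] := eqVneq (size x) m; last by exists 0 => /eqP; rewrite (negbTE sx).
    by have := ptP x sx; rewrite -piQ => -[y Qy ey]; exists y.
  by exists (fun x => projT1 (cid (ex x))) => x; case: cid.
have [num [numI numinj _]] : exists f, set_bij [set F | facet Q F] `I_r f.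
  by move/card_set_bijP: cardQ => [f fbij]; exists f.
pose fc y := [set u | Q u /\ l y (pi u) = c y].
have fc_face y : size y = m -> fc y !=set0 -> face Q (fc y).
  move=> sy ne; split=> //.
  pose f : {linear 'rV[R]_d -> R^o} := l y \o pi.
  exists (- \col_i f 'e_i), (- c y).
  have e u : (u *m (- \col_i f 'e_i)) 0 0 = - l y (pi u).
    by rewrite mulmxN mxE linear_functional_col.
  split=> [u Qu|]; first by rewrite e lerN2; apply: lP => //; rewrite -piQ; exists u.
  apply/seteqP; split=> u /= [Qu]; rewrite e; first by move=> ->.
  by move/oppr_inj.
(* Index [r] is the extra rectangle, formed by all pairs in which [y] is the empty subset; for this
   [y] no given point is tight and [fc y] may be empty. *)
pose A (j : 'I_r.+1) x := (j == r :> nat) ||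
  `[< exists G, [/\ facet Q G, num G = j & ~ G (lift x)] >].
pose B (j : 'I_r.+1) y :=
  if j == r :> nat then ~~ has id y
  else (fc y != set0) && `[< exists G, [/\ facet Q G, num G = j & fc y `<=` G] >].
apply: (@rectangle_cover m r.+1 A B) => [j x y sx sy|x y sx sy xy].
  rewrite /A /B; case: eqP => [_ _ yf|_ /=].
    suff -> : common x y = 0%N by [].
    elim: x y {sx sy} yf => [|a x IH] [|b y] //=; rewrite negb_or => /andP[/negbTE->].
    by rewrite andbF => /IH.
  move=> /asboolP[G [fG nG Glx]] /andP[_ /asboolP[G' [fG' nG' fcG']]].
  have eG : G = G' by apply: numinj; rewrite ?inE // nG nG'.
  rewrite -slk //; apply/eqP => e; apply: Glx; rewrite eG; apply: fcG'.
  by have [Qx ex] := lift_ok x sx; split=> //; rewrite ex.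
have [yt|yf] := boolP (has id y); last first.
  by exists ord_max; rewrite /A /B /= eqxx.
(* The witness [x'] is the singleton of the first element of [y], so its point is tight for [y]. *)
have ne : fc y !=set0.
  pose i := find id y.
  have im : (i < m)%N by rewrite -sy -has_find.
  pose x' := nseq i false ++ true :: nseq (m - i.+1) false.
  have sx' : size x' = m by rewrite size_cat /= !size_nseq; lia.
  have cx' : common x' y = 1%N.
    have cf : forall p z, common (nseq p false) z = 0%N.
      by elim=> [|p IH] [|? z] //=; rewrite IH.
    rewrite /x' /i; move: (m - _)%N => q; elim: y yt {sy im x' sx' i slk lP xy} => //= b y IH.
    by case: b => /= [_|/IH //]; rewrite cf.
  exists (lift x'); have [Qx ex] := lift_ok _ sx'; split=> //.
  by rewrite ex; apply/eqP; rewrite slk // cx'.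
have [Qx ex] := lift_ok x sx.
have nfx : ~ fc y (lift x).
  by move=> [_ /eqP]; rewrite ex slk // xy.
have [G [fG sub nG]] := facet_separates polQ (fc_face _ sy ne) Qx nfx.
have nr : (num G < r)%N by apply: numI.
exists (Ordinal (ltnW nr : num G < r.+1)%N); rewrite /A /B /= (ltn_eqF nr) /=.
apply/andP; split; first by apply/asboolP; exists G.
by apply/andP; split; [apply/set0P|apply/asboolP; exists G].
Qed.

(** * Finite descriptions of the comb polyhedra *)

Section FiniteSystems.
Variables (R : realType) (n : nat).

Definition edge_of_row (y : 'rV[R]_#|edge n|) : edge_vec R n :=
  [ffun e => y 0 (enum_rank e)].

Lemma edge_of_row_linear : linear edge_of_row.
Proof. by move=> t y z; apply/ffunP => e; rewrite !ffunE !mxE. Qed.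

HB.instance Definition _ :=
  GRing.isLinear.Build R _ _ _ edge_of_row edge_of_row_linear.

(** The polyhedron, in row coordinates, is an extension of itself with finitely many facets. This
    keeps [xc] from taking its default value 0. *)
Lemma finite_system_extension (I : finType) (a : I -> edge n -> R) (c : I -> R) :
  exists r, has_extension
    ([set x | forall i, c i <= \sum_e a i e * x e] : set (edge_vec R n)) r.
Proof.
pose A : 'M[R]_(#|edge n|, #|I|) := \matrix_(p, q) - a (enum_val q) (enum_val p).
pose b : 'rV[R]_#|I| := \row_q - c (enum_val q).
pose Q := [set y : 'rV[R]_#|edge n| | forall j, (y *m A) 0 j <= b 0 j].
have polQ : polyhedron Q by exists #|I|, A, b.
have /finite_setP[r cardr] := polyhedron_facets_finite polQ.
exists r, #|edge n|, Q, edge_of_row; split=> //.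
have row_val y q : (y *m A) 0 q = - \sum_e a (enum_val q) e * edge_of_row y e.
  rewrite mxE -sumrN [RHS](reindex (@enum_val _ (edge n))) /=; last first.
    by exists enum_rank => p _; rewrite ?enum_valK ?enum_rankK.
  by apply: eq_bigr => p _; rewrite ffunE mxE enum_valK; ring.
apply/seteqP; split=> x /=.
  move=> [y Qy <-] i; have := Qy (enum_rank i).
  by rewrite row_val mxE lerN2 enum_rankK.
move=> sys; have ey : edge_of_row (\row_p x (enum_val p)) = x.
  by apply/ffunP => e; rewrite ffunE mxE enum_rankK.
by exists (\row_p x (enum_val p)) => // q; rewrite row_val ey mxE lerN2.
Qed.

Definition comb_value (x : edge_vec R n) k (H : {set 'I_n}) (T : 'I_k -> {set 'I_n}) : R :=
  edge_sum x (cut H) + \sum_(i < k) edge_sum x (cut (T i)).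

Lemma edge_sumE (x : edge_vec R n) (F : {set edge n}) :
  edge_sum x F = \sum_e (e \in F)%:R * x e.
Proof.
by rewrite /edge_sum big_mkcond; apply: eq_bigr => e _; case: (e \in F); rewrite ?mul1r ?mul0r.
Qed.

Definition comb_coef k (H : {set 'I_n}) (T : 'I_k -> {set 'I_n}) e : R :=
  (e \in cut H)%:R + \sum_(i < k) (e \in cut (T i))%:R.

Lemma comb_valueE x k H (T : 'I_k -> {set 'I_n}) :
  comb_value x H T = \sum_e comb_coef H T e * x e.
Proof.
rewrite /comb_value edge_sumE.
under [X in _ + X]eq_bigr => i _ do rewrite edge_sumE.
rewrite exchange_big -big_split /=; apply: eq_bigr => e _.
by rewrite mulrDl mulr_suml.
Qed.

Definition comb_functional k (H : {set 'I_n}) (T : 'I_k -> {set 'I_n})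
  (x : edge_vec R n) : R^o := comb_value x H T.

Lemma comb_functional_linear k H (T : 'I_k -> {set 'I_n}) :
  linear (comb_functional H T).
Proof.
move=> t x y; rewrite /comb_functional !comb_valueE scaler_sumr -big_split /=.
by apply: eq_bigr => e _; rewrite !ffunE mulrDr; congr (_ + _); rewrite mulrCA.
Qed.

HB.instance Definition _ k H (T : 'I_k -> {set 'I_n}) :=
  GRing.isLinear.Build R _ _ _ (comb_functional H T) (comb_functional_linear H T).

(** Disjoint nonempty teeth have distinct representatives. The bound makes the comb inequalities a
    finite system. *)
Lemma comb_teeth_le k (H : {set 'I_n}) (T : 'I_k -> {set 'I_n}) :
  comb H T -> (k <= n)%N.
Proof.
move=> [_ HT _ disj _].
have ex i : exists v, v \in T i by have /set0Pn[v] := HT i; rewrite inE => /andP[_]; exists v.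
pose f i := xchoose (ex i).
have fT i : f i \in T i := xchooseP (ex i).
rewrite -(card_ord k) -(card_ord n); apply: (leq_card f) => i j fij.
apply/eqP; apply: contraT => ij; have := fT i; have := fT j; rewrite -fij => fj fi.
have : f i \in (T i :&: T j)%SET by rewrite inE fi.
by rewrite disj // inE.
Qed.

Definition comb_index : finType :=
  {k : 'I_n.+1 & ({set 'I_n} * {ffun 'I_k -> {set 'I_n}})%type}.

Definition index_handle (i : comb_index) := (tagged i).1.
Definition index_teeth (i : comb_index) : 'I_(tag i) -> {set 'I_n} := (tagged i).2.

Lemma comb_indexP k (H : {set 'I_n}) (T : 'I_k -> {set 'I_n}) : comb H T ->
  exists i : comb_index, [/\ comb (index_handle i) (@index_teeth i), tag i = k :> nat &
    forall x, comb_value x (index_handle i) (@index_teeth i) = comb_value x H T].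
Proof.
move=> cHT; have kn := comb_teeth_le cHT.
pose o := Ordinal (kn : (k < n.+1)%N).
pose i : comb_index := Tagged (fun k : 'I_n.+1 => ({set 'I_n} * {ffun 'I_k -> {set 'I_n}})%type)
  (H, [ffun j : 'I_o => T j]).
have e : @index_teeth i = T by apply/funext => j; rewrite /index_teeth /= ffunE.
by exists i; split=> //; rewrite e.
Qed.

(** An index that is not a comb yields the trivial inequality [0 <= 0]. *)
Definition index_coef (i : comb_index) (e : edge n) : R :=
  if `[< comb (index_handle i) (@index_teeth i) >]
  then comb_coef (index_handle i) (@index_teeth i) e else 0.

Definition index_rhs (i : comb_index) : R :=
  if `[< comb (index_handle i) (@index_teeth i) >] then (3 * tag i + 1)%:R else 0.

Lemma COMB_system :
  COMB R n = [set x | forall i, index_rhs i <= \sum_e index_coef i e * x e].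
Proof.
apply/seteqP; split=> x /=.
  move=> Cx i; rewrite /index_rhs /index_coef; case: asboolP => c.
    by rewrite -comb_valueE; apply: Cx.
  by rewrite big1 // => e _; rewrite mul0r.
move=> sys k H T cHT; have [i [ci ki vi]] := comb_indexP cHT.
have := sys i; rewrite /index_rhs /index_coef.
case: asboolP => // _; rewrite -comb_valueE vi ki.
exact.
Qed.

Lemma COMB_extension : exists r, has_extension (COMB R n) r.
Proof. by rewrite COMB_system; apply: finite_system_extension. Qed.

Lemma COMB_deg_extension : exists r, has_extension (COMB_deg R n) r.
Proof.
pose I : finType := (comb_index + 'I_n * bool)%type.
pose a (i : I) e : R := match i with
  | inl i => index_coef i e
  | inr (v, s) => (-1) ^+ s * (e \in cut [set v]%SET)%:R end.
pose c (i : I) : R := match i with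
  | inl i => index_rhs i | inr (_, s) => (-1) ^+ s * 2 end.
suff -> : COMB_deg R n = [set x | forall i, c i <= \sum_e a i e * x e].
  exact: finite_system_extension.
have deg (x : edge_vec R n) v s : \sum_e a (inr (v, s)) e * x e =
    (-1) ^+ s * edge_sum x (cut [set v]%SET).
  by rewrite edge_sumE mulr_sumr; apply: eq_bigr => e _; rewrite /= mulrA.
apply/seteqP; split=> x /=.
  rewrite /COMB_deg COMB_system => -[Cx dx] [i|[v s]]; first exact: Cx.
  by rewrite deg dx.
move=> sys; split; first by rewrite COMB_system => i; apply: (sys (inl i)).
move=> v; have := sys (inr (v, false)); have := sys (inr (v, true)).
by rewrite !deg /= expr0 expr1 !mul1r !mulN1r lerN2 => le1 le2; apply/eqP; rewrite eq_le le1.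
Qed.

End FiniteSystems.

Lemma xc_ge (R : realType) (V : lmodType R) (P : set V) (b : nat) :
  (exists r, has_extension P r) -> (forall r, has_extension P r -> (b <= r)%N) ->
  (b <= xc P)%N.
Proof.
move=> [r ex] lb; rewrite /xc; case: pselect => [h|[]]; last first.
  by exists r; apply/asboolP.
by case: ex_minnP => q /asboolP/lb.
Qed.

(** * Edge vectors and cuts *)

Lemma cards2I (T : finType) (a b : T) (S : {set T}) : a != b ->
  #|([set a; b] :&: S)%SET| = ((a \in S) + (b \in S))%N.
Proof.
move=> ab; rewrite finset.setIUl cardsU.
have single c : #|([set c] :&: S)%SET| = (c \in S).
  have [cS|cS] := boolP (c \in S).
    by rewrite (finset.setIidPl _) ?cards1 // finset.sub1set.
  by apply/eqP; rewrite cards_eq0 setI_eq0 disjoints1.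
rewrite !single (_ : _ :&: _ = finset.set0)%SET ?cards0 ?subn0 //.
apply/eqP; rewrite -finset.subset0; apply/fintype.subsetP => x.
rewrite !inE => /andP[/andP[/eqP-> _] /andP[/eqP e _]].
by rewrite e eqxx in ab.
Qed.

Section Cuts.
Variables (R : realType) (n : nat) (V : finType) (phi : V -> 'I_n).

(** For [phi u = phi v] this is the zero vector, in accordance with [cross], since an edge has two
    elements. *)
Definition unit_edge (u v : V) : edge_vec R n :=
  [ffun e => (val e == [set phi u; phi v]%SET)%:R].

Lemma edge_sum_unit u v (S : {set 'I_n}) :
  edge_sum (unit_edge u v) (cut S) = (cross (fun w => phi w \in S) u v)%:R.
Proof.
rewrite /edge_sum /cross.
have [uv|uv] := eqVneq (phi u) (phi v).
  rewrite uv addbb big1 // => e _; rewrite ffunE.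
  case: eqP => // ve; have := valP e; rewrite /= ve uv finset.setUid cards1.
  by [].
have c2 : #|[set phi u; phi v]%SET| == 2%N by rewrite cards2 uv.
pose e0 : edge n := exist (fun e : {set 'I_n} => #|e| == 2%N) _ c2.
rewrite big_mkcond (bigD1 e0) //= big1 ?addr0 => [|e ee0].
  rewrite inE /= cards2I // ffunE eqxx.
  by case: (phi u \in S); case: (phi v \in S).
rewrite ffunE; case: eqP => [ve|_]; last by case: ifP.
by case/eqP: ee0; apply: val_inj.
Qed.

Lemma edge_sum_sum (I : Type) (r : seq I) (f : I -> edge_vec R n) F :
  edge_sum (\sum_(i <- r) f i) F = \sum_(i <- r) edge_sum (f i) F.
Proof.
rewrite /edge_sum exchange_big /=; apply: eq_bigr => e _.
by rewrite sum_ffunE.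
Qed.

Lemma edge_sumZ t (x : edge_vec R n) F : edge_sum (t *: x) F = t * edge_sum x F.
Proof. by rewrite /edge_sum mulr_sumr; apply: eq_bigr => e _; rewrite !ffunE. Qed.

Lemma edge_sumD (x y : edge_vec R n) F :
  edge_sum (x + y) F = edge_sum x F + edge_sum y F.
Proof. by rewrite /edge_sum -big_split; apply: eq_bigr => e _; rewrite !ffunE. Qed.

Definition cycle_vec (x0 : V) (t : seq V) : edge_vec R n :=
  \sum_(p <- pairmap pair (last x0 t) t) unit_edge p.1 p.2.

Lemma edge_sum_cycle x0 t (S : {set 'I_n}) :
  edge_sum (cycle_vec x0 t) (cut S) =
  (cycle_cost (cross (fun w => phi w \in S)) x0 t)%:R.
Proof.
rewrite edge_sum_sum natr_sum; apply: eq_bigr => p _; exact: edge_sum_unit.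
Qed.

Lemma comb_value_cycle x0 t K (H : {set 'I_n}) (T : 'I_K -> {set 'I_n}) :
  comb_value (cycle_vec x0 t) H T =
  (cycle_cost (comb_cost (fun w => phi w \in H) (fun j w => phi w \in T j)) x0 t)%:R.
Proof.
rewrite cycle_comb_cost natrD [X in _ = _ + X]natr_sum /comb_value edge_sum_cycle; congr (_ + _).
by apply: eq_bigr => j _; rewrite edge_sum_cycle.
Qed.

Definition mass (y : V -> R) (S : V -> bool) : R := \sum_u y u * (S u)%:R.

(** A product of two vertex weightings: its value on a cut depends only on their masses on the two
    sides. *)
Definition tensor (y z : V -> R) : edge_vec R n :=
  \sum_u \sum_v (y u * z v) *: unit_edge u v.

Lemma edge_sum_tensor y z (S : {set 'I_n}) :
  edge_sum (tensor y z) (cut S) =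
  mass y (fun w => phi w \in S) * mass z (fun w => phi w \notin S) +
  mass y (fun w => phi w \notin S) * mass z (fun w => phi w \in S).
Proof.
rewrite /tensor edge_sum_sum /mass !mulr_suml -big_split; apply: eq_bigr => u _ /=.
rewrite edge_sum_sum !mulr_sumr -big_split; apply: eq_bigr => v _ /=.
rewrite edge_sumZ edge_sum_unit /cross.
by case: (phi u \in S); case: (phi v \in S) => /=; ring.
Qed.

End Cuts.

(** * Directions *)

Lemma common_sum m x y : size x = m -> size y = m ->
  common x y = (\sum_(j < m) (nth false x j && nth false y j))%N.
Proof.
elim: m x y => [|m IH] [|a x] [|b y] //=; first by rewrite big_ord0.
by case=> sx [sy]; rewrite big_ord_recl /= (IH x y).
Qed.

Lemma mass_point (R : realType) (V : finType) (a : V) (S : V -> bool) :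
  mass (fun u => (u == a)%:R : R) S = (S a)%:R.
Proof.
rewrite /mass (bigD1 a) //= eqxx mul1r big1 ?addr0 // => u ua.
by rewrite (negbTE ua) mul0r.
Qed.

Section Directions.
Variables (R : realType) (n k m : nat) (phi : vertex k m -> 'I_n).
Hypothesis m2_le_k : (m.+2 <= k)%N.
Notation V := (vertex k m).

Let m_le_k : (m <= k)%N := leq_trans (leqW (leqnSn m)) m2_le_k.
Let i1 : 'I_k := Ordinal (leq_trans (leqnSn m.+1) m2_le_k).
Let i2 : 'I_k := Ordinal m2_le_k.

Notation sl := (slot_of m_le_k).

Definition mid_mass (x : bitseq) (u : V) : R :=
  if u is Some (inr j) then (nth false x j)%:R else 0.

Definition point_mass (a u : V) : R := (u == a)%:R.

(* Up to degree corrections on the four end vertices of two paths without a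
   middle vertex, this is the quadratic form [4 (1 - |x /\ y|)^2]: its value on
   the cut of [handle y].  All degrees vanish, and so does the cut of every
   subset of a path. *)
Definition direction (x : bitseq) : edge_vec R n :=
  let Y := mid_mass x in
  let s := mass Y xpredT in
  let a1 := point_mass (top_end m i1) in let a2 := point_mass (top_end m i2) in
  let b1 := point_mass (bot_end m i1) in let b2 := point_mass (bot_end m i2) in
  (-2) *: tensor phi Y Y + (tensor phi Y a1 + tensor phi Y a2) +
  (2 * s - 3) *: (tensor phi Y b1 + tensor phi Y b2) +
  (2 - s) *: (tensor phi a1 b2 + tensor phi a2 b1) +
  (-2) *: tensor phi a1 a2 + (-2 * (s - 1) ^+ 2) *: tensor phi b1 b2.

Lemma mass_mid x (S : V -> bool) :
  mass (mid_mass x) S = \sum_(j < m) (nth false x j)%:R * (S (mid k j))%:R.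
Proof.
rewrite /mass (bigID (fun u : V => if u is Some (inr _) then true else false)) /=.
rewrite [X in _ + X]big1 ?addr0; last first.
  by case=> [[[?|?]|?]|] //= _; rewrite mul0r.
rewrite (reindex_omap (fun j => mid k j)
  (fun u : V => if u is Some (inr j) then Some j else None)) /=.
  by apply: eq_bigl => j; rewrite eqxx.
by case=> [[[?|?]|?]|].
Qed.

Lemma mass_split (y : V -> R) (S : V -> bool) :
  mass y S + mass y (fun u => ~~ S u) = mass y xpredT.
Proof.
rewrite /mass -big_split; apply: eq_bigr => u _ /=.
by rewrite -mulrDr; congr (_ * _); case: (S u) => /=; ring.
Qed.

Section DirectionCut.
Variables (x : bitseq) (S : {set 'I_n}).
Let P w := phi w \in S.
Let p := mass (mid_mass x) P.
Let s := mass (mid_mass x) xpredT.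

Lemma direction_cut : let q := s - p in
  let a1 : R := (P (top_end m i1))%:R in let a2 : R := (P (top_end m i2))%:R in
  let b1 : R := (P (bot_end m i1))%:R in let b2 : R := (P (bot_end m i2))%:R in
  edge_sum (direction x) (cut S) =
  -4 * p * q + (p * (2 - a1 - a2) + q * (a1 + a2)) +
  (2 * s - 3) * (p * (2 - b1 - b2) + q * (b1 + b2)) +
  (2 - s) * (a1 * (1 - b2) + (1 - a1) * b2 + a2 * (1 - b1) + (1 - a2) * b1) +
  -2 * (a1 * (1 - a2) + (1 - a1) * a2) +
  -2 * (s - 1) ^+ 2 * (b1 * (1 - b2) + (1 - b1) * b2).
Proof.
move=> q a1 a2 b1 b2.
have eq : mass (mid_mass x) (fun w => phi w \notin S) = q.
  by rewrite /q; have := mass_split (mid_mass x) P; rewrite -/p -/s => <-; rewrite (addrC p) addrK.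
have neg a : (phi a \notin S)%:R = 1 - (P a)%:R :> R.
  by rewrite /P; case: (phi a \in S) => /=; ring.
have lin (v1 v2 v3 v4 v5 v6 v7 v8 v9 : edge_vec R n) (c1 c2 c3 c4 c5 : R)
    e1 e2 e3 e4 e5 e6 e7 e8 e9 F :
    edge_sum v1 F = e1 -> edge_sum v2 F = e2 -> edge_sum v3 F = e3 ->
    edge_sum v4 F = e4 -> edge_sum v5 F = e5 -> edge_sum v6 F = e6 ->
    edge_sum v7 F = e7 -> edge_sum v8 F = e8 -> edge_sum v9 F = e9 ->
    edge_sum (c1 *: v1 + (v2 + v3) + c2 *: (v4 + v5) + c3 *: (v6 + v7) +
      c4 *: v8 + c5 *: v9) F =
    c1 * e1 + (e2 + e3) + c2 * (e4 + e5) + c3 * (e6 + e7) + c4 * e8 + c5 * e9.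
  by do 9!move=> <-; rewrite 6!edge_sumD 5!edge_sumZ 2!edge_sumD.
have T y z := edge_sum_tensor phi y z S.
apply: etrans; first by apply: lin; apply: T.
rewrite eq.
rewrite !mass_point.
rewrite !neg -/P -/p -/s -/a1 -/a2 -/b1 -/b2.
ring.
Qed.

(** If [S] contains a middle vertex selected by [x], it contains just one and no end of [i1] or
    [i2], whose indices [m] and [m.+1] belong to paths without middle vertex. Otherwise it contains
    ends of at most one of these two paths. The cut vanishes in each case. *)
Lemma direction_path i : (forall v, P v -> sl v = i) ->
  edge_sum (direction x) (cut S) = 0.
Proof.
move=> Si; rewrite direction_cut.
have top_mid (j : 'I_m) (i' : 'I_k) v : (m <= i')%N -> P (mid k j) ->
    sl v = Some i' -> P v = false.
  move=> mi Pj vi; apply/negP => /Si; rewrite vi -(Si _ Pj) /= => -[].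
  by move/(congr1 val) => /= e; have := ltn_ord j; rewrite ltnNge -e mi.
have [/existsP[j /andP[xj Pj]]|/existsPn no] :=
    boolP [exists j : 'I_m, nth false x j && P (mid k j)].
  have -> : p = 1.
    rewrite /p mass_mid (bigD1 j) //= xj Pj mul1r big1 ?addr0 // => j' jj'.
    case: (boolP (P (mid k j'))) => [/Si|_]; last by rewrite mulr0.
    rewrite -(Si _ Pj) /= => -[e]; case/eqP: jj'; apply: val_inj; exact: e.
  rewrite (top_mid j i1 (top_end m i1) (leqnn m) Pj erefl).
  rewrite (top_mid j i2 (top_end m i2) (leqnSn m) Pj erefl).
  rewrite (top_mid j i1 (bot_end m i1) (leqnn m) Pj erefl).
  rewrite (top_mid j i2 (bot_end m i2) (leqnSn m) Pj erefl) /=.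
  by ring.
have -> : p = 0.
  rewrite /p mass_mid big1 // => j _; have := no j.
  by case: (nth _ _ _); case: (P _) => //= _; rewrite ?mulr0 ?mul0r.
have excl u v : sl u = Some i1 -> sl v = Some i2 -> P u && P v = false.
  move=> u1 v2; apply/negP => /andP[/Si + /Si]; rewrite u1 v2 => <- [].
  by lia.
have := excl (top_end m i1) (top_end m i2) erefl erefl.
have := excl (bot_end m i1) (top_end m i2) erefl erefl.
have := excl (top_end m i1) (bot_end m i2) erefl erefl.
have := excl (bot_end m i1) (bot_end m i2) erefl erefl.
by case: (P (top_end m i1)); case: (P (top_end m i2)); case: (P (bot_end m i1));
  case: (P (bot_end m i2)) => //= _ _ _ _; ring.
Qed.

(** A set and its complement have the same cut, so for [b = false] the mass outside [S] takes the
    place of the mass inside. *)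
Lemma direction_handle b : (forall i, P (top_end m i) = b /\ P (bot_end m i) = ~~ b) ->
  edge_sum (direction x) (cut S) = 4 * (1 - (if b then p else s - p)) ^+ 2.
Proof.
move=> Pb; rewrite direction_cut.
rewrite (proj1 (Pb i1)) (proj2 (Pb i1)) (proj1 (Pb i2)) (proj2 (Pb i2)).
by case: b {Pb} => /=; ring.
Qed.

End DirectionCut.

End Directions.

(** * Points of the comb polyhedra *)

Section Points.
Variables (R : realType) (n k m : nat).
Variables (phi : vertex k m -> 'I_n) (psi : 'I_n -> vertex k m).
Hypotheses (phiK : cancel phi psi) (psiK : cancel psi phi).
Hypotheses (m2_le_k : (m.+2 <= k)%N) (k_odd : odd k) (k_gt4 : (4 < k)%N).
Notation V := (vertex k m).
Notation slots := (enum {: slot k}).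
Notation hub := (hub k m).

Let m_le_k : (m <= k)%N := leq_trans (leqW (leqnSn m)) m2_le_k.
Notation sl := (slot_of m_le_k).

Definition tours : seq (seq V) :=
  [seq tour m d s | d <- [:: true; false], s <- permutations slots].

Lemma toursP t : reflect (exists d s, perm_eq s slots /\ t = tour m d s) (t \in tours).
Proof.
apply: (iffP allpairsP) => [[[d s] [_ /=]]|[d [s [ps ->]]]].
  by rewrite mem_permutations => ps ->; exists d, s.
by exists (d, s); rewrite mem_permutations; split=> //; case: d.
Qed.

Definition center : edge_vec R n :=
  (size tours)%:R^-1 *: \sum_(t <- tours) cycle_vec R phi hub t.

Lemma size_tours_gt0 : 0 < (size tours)%:R :> R.
Proof.
rewrite ltr0n -has_predT; apply/hasP; exists (tour m true slots) => //.
by apply/toursP; exists true, slots.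
Qed.

Lemma edge_sum_center (S : {set 'I_n}) : edge_sum center (cut S) = (size tours)%:R^-1 *
  \sum_(t <- tours) (cycle_cost (cross (fun w => phi w \in S)) hub t)%:R.
Proof.
rewrite edge_sumZ edge_sum_sum; congr (_ * _); apply: eq_bigr => t _.
exact: edge_sum_cycle.
Qed.

Lemma average_const (f : seq V -> nat) c : (forall t, t \in tours -> f t = c) ->
  (size tours)%:R^-1 * \sum_(t <- tours) (f t)%:R = c%:R :> R.
Proof.
move=> fc; rewrite big_seq (eq_bigr (fun=> c%:R)); last by move=> t /fc->.
rewrite -big_seq big_const_seq count_predT iter_addr_0 -[c%:R *+ _]mulr_natl mulKf //.
by rewrite gt_eqF // size_tours_gt0.
Qed.

Lemma comb_value_center K (H : {set 'I_n}) (T : 'I_K -> {set 'I_n}) :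
  comb_value center H T = (size tours)%:R^-1 * \sum_(t <- tours)
   (cycle_cost (comb_cost (fun w => phi w \in H) (fun j w => phi w \in T j)) hub t)%:R.
Proof.
have -> : comb_value center H T = comb_functional H T center by [].
rewrite linearZ linear_sum; congr (_ * _); apply: eq_bigr => t _.
exact: comb_value_cycle.
Qed.

Section Comb.
Variables (K : nat) (H : {set 'I_n}) (T : 'I_K -> {set 'I_n}).
Hypothesis cHT : comb H T.
Let Hv w := phi w \in H.
Let Tv j w := phi w \in T j.

Let T_disjoint : forall i j v, Tv i v -> Tv j v -> i = j.
Proof.
move=> i j v vi vj; case: cHT => _ _ _ disj _; apply/eqP; apply: contraT => ij.
have : phi v \in (T i :&: T j)%SET by rewrite inE; apply/andP.
by rewrite disj // inE.
Qed.

Let T_in : forall i, exists v, Tv i v && Hv v.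
Proof.
move=> i; case: cHT => _ HT _ _ _; have /set0Pn[v] := HT i.
by rewrite inE andbC => vi; exists (psi v); rewrite /Tv /Hv psiK.
Qed.

Let T_out : forall i, exists v, Tv i v && ~~ Hv v.
Proof.
move=> i; case: cHT => _ _ TH _ _; have /set0Pn[v] := TH i.
by rewrite inE andbC => vi; exists (psi v); rewrite /Tv /Hv psiK.
Qed.

Let K_gt2 : (2 < K)%N. Proof. by case: cHT => -[]. Qed.
Let K_odd : odd K. Proof. by case: cHT => -[]. Qed.

(** All tours satisfy the comb inequality, so the truncated subtraction is exact and the slack of
    [center] is an average of natural numbers. *)
Lemma center_slack : comb_value center H T - (3 * K + 1)%:R =
  (size tours)%:R^-1 * \sum_(t <- tours)
    (cycle_cost (comb_cost Hv Tv) hub t - (3 * K + 1))%:R.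
Proof.
rewrite comb_value_center -(@average_const (fun=> (3 * K + 1)%N) (3 * K + 1)) // -mulrBr -sumrB.
congr (_ * _); rewrite big_seq [RHS]big_seq; apply: eq_bigr => t /toursP[d [s [ps ->]]].
by rewrite natrB // (tour_comb_valid m_le_k).
Qed.

Lemma center_slack_ge0 : (3 * K + 1)%:R <= comb_value center H T.
Proof.
rewrite -subr_ge0 center_slack mulr_ge0 ?invr_ge0 ?ler0n //.
by apply: sumr_ge0 => t _; rewrite ler0n.
Qed.

(** A comb tight at [center] is tight on every tour. By [tight_comb_shape], the direction then has
    value 0 on its teeth and four times a square on its handle. *)
Lemma center_slack_eq0 : comb_value center H T = (3 * K + 1)%:R ->
  forall x, 0 <= comb_value (direction R phi m2_le_k x) H T.
Proof.
move=> /eqP; rewrite -subr_eq0 center_slack mulf_eq0 invr_eq0 gt_eqF ?size_tours_gt0 //=.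
rewrite -natr_sum pnatr_eq0 sum_nat_seq_eq0 => /allP tight x.
have tight' d s : perm_eq s slots ->
    (cycle_cost (comb_cost Hv Tv) hub (tour m d s) <= 3 * K + 1)%N.
  by move=> ps; rewrite -subn_eq0; apply: tight; apply/toursP; exists d, s.
have [[b Hb] Ti] := tight_comb_shape m_le_k k_odd k_gt4 T_disjoint T_in T_out
  K_odd K_gt2 tight'.
rewrite /comb_value (direction_handle R m2_le_k x Hb) big1 ?addr0.
  by rewrite mulr_ge0 ?sqr_ge0.
by move=> j _; have [i ji] := Ti j; apply: (direction_path _ _ ji).
Qed.

End Comb.

Lemma center_deg v : edge_sum center (cut [set v]%SET) = 2.
Proof.
rewrite edge_sum_center (average_const (c := 2)) // => t /toursP[d [s [ps ->]]].
rewrite -(tour_vertex_cut m_le_k k_odd (psi v) d ps); congr cycle_cost.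
apply/funext => u; apply/funext => w; rewrite /cross !inE.
by rewrite -(can_eq phiK) -(can_eq phiK w) psiK.
Qed.

Lemma direction_deg x v : edge_sum (direction R phi m2_le_k x) (cut [set v]%SET) = 0.
Proof.
apply: (@direction_path _ _ _ _ _ _ _ _ (sl (psi v))) => u.
by rewrite inE => /eqP <-; rewrite phiK.
Qed.

Lemma comb_valueDZ (u w : edge_vec R n) t K (H : {set 'I_n}) (T : 'I_K -> {set 'I_n}) :
  comb_value (u + t *: w) H T = comb_value u H T + t * comb_value w H T.
Proof.
have -> : comb_value (u + t *: w) H T = comb_functional H T (u + t *: w) by [].
by rewrite linearD linearZ.
Qed.

Lemma point_exists x : exists2 t : R, 0 < t &
  COMB_deg R n (center + t *: direction R phi m2_le_k x).
Proof.
set w := direction R phi m2_le_k x.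
pose slack (i : comb_index n) : R :=
  comb_value center (index_handle i) (@index_teeth _ i) - (3 * tag i + 1)%:R.
pose dir (i : comb_index n) : R := - comb_value w (index_handle i) (@index_teeth _ i).
(* Only the finitely many combs with positive slack at [center] limit the step; the tight ones are
   handled by [center_slack_eq0]. *)
have [i|t t0 ts] := @common_scaling R _ (enum [pred i | 0 < slack i]) slack dir.
  by rewrite mem_enum.
exists t => //; split=> [K H T cHT|v]; last first.
  by rewrite edge_sumD center_deg edge_sumZ direction_deg mulr0 addr0.
have [i [ci eK vi]] := comb_indexP R cHT.
change ((3 * K + 1)%:R <= comb_value (center + t *: w) H T).
rewrite -vi comb_valueDZ -eK.
have s0 : 0 <= slack i by rewrite subr_ge0; apply: center_slack_ge0.
have [e0|ne0] := eqVneq (slack i) 0.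
  have e : comb_value center (index_handle i) (@index_teeth _ i) = (3 * tag i + 1)%:R.
    by apply/eqP; rewrite -subr_eq0; apply/eqP.
  by rewrite e lerDl mulr_ge0 ?(ltW t0) //; apply: center_slack_eq0.
have := ts i; rewrite mem_enum inE lt_neqAle eq_sym ne0 s0 => /(_ isT).
by rewrite /dir /slack mulrN; lra.
Qed.

Definition column_handle (y : bitseq) : {set 'I_n} :=
  [set v | handle y (psi v)]%SET.

Definition column_tooth (i : 'I_k) : {set 'I_n} :=
  [set v | sl (psi v) == Some i]%SET.

Lemma column_comb y : comb (column_handle y) column_tooth.
Proof.
split.
- by split=> //; apply: ltnW; apply: ltnW.
- by move=> i; apply/set0Pn; exists (phi (top_end m i)); rewrite !inE phiK /= eqxx.
- by move=> i; apply/set0Pn; exists (phi (bot_end m i)); rewrite !inE phiK /= eqxx.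
- move=> i j ij; apply/setP => v; rewrite !inE; apply/negP => /andP[/eqP-> /eqP[e]].
  by rewrite e eqxx in ij.
apply/set0Pn; exists (phi hub); rewrite !inE phiK andbT.
by apply/bigcupP => -[i _]; rewrite inE phiK.
Qed.

Lemma column_center y : comb_value center (column_handle y) column_tooth = (3 * k + 1)%:R.
Proof.
rewrite comb_value_center (average_const (c := (3 * k + 1)%N)) // => t /toursP[d [s [ps ->]]].
rewrite -(tour_handle_tight m_le_k k_odd y d ps); congr cycle_cost.
apply/funext => u; apply/funext => w; rewrite /comb_cost /cross !inE !phiK; congr (_ + _)%N.
by apply: eq_bigr => j _; rewrite !inE !phiK.
Qed.

Lemma column_direction x y : size x = m -> size y = m ->
  comb_value (direction R phi m2_le_k x) (column_handle y) column_tooth =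
  4 * (1 - (common x y)%:R) ^+ 2.
Proof.
move=> sx sy; rewrite /comb_value big1 ?addr0; last first.
  move=> i _; apply: (@direction_path _ _ _ _ _ _ _ _ (Some i)) => v.
  by rewrite inE phiK => /eqP.
rewrite (@direction_handle _ _ _ _ _ _ _ _ true); last by move=> i; rewrite !inE !phiK.
congr (4 * (1 - _) ^+ 2); rewrite mass_mid (common_sum sx sy) natr_sum.
by apply: eq_bigr => j _; rewrite inE phiK /= -natrM mulnb.
Qed.

(** The points satisfy the degree equations and the inequalities are comb inequalities, so any set
    between [COMB_deg] and [COMB] is covered. The step [t x] varies with [x], but it is positive and
    only the vanishing of the slack counts. *)
Lemma COMB_extension_lower_bound (P : set (edge_vec R n)) r :
  COMB_deg R n `<=` P -> P `<=` COMB R n -> has_extension P r ->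
  (3 ^ m <= r.+1 * 2 ^ m)%N.
Proof.
move=> degP PC.
pose t x := sval (cid2 (point_exists x)).
have t0 x : 0 < t x by rewrite /t; case: cid2.
have tP x : COMB_deg R n (center + t x *: direction R phi m2_le_k x).
  by rewrite /t; case: cid2.
apply: (@extension_disjointness _ _ P m r
  (fun x => center + t x *: direction R phi m2_le_k x)
  (fun y => comb_functional (column_handle y) column_tooth)
  (fun=> (3 * k + 1)%:R)) => [x _|y v sy Pv|x y sx sy].
- exact/degP/tP.
- by have := PC _ Pv k _ _ (column_comb y).
rewrite /= /comb_functional comb_valueDZ column_center column_direction //.
rewrite -subr_eq0 addrC addKr mulf_eq0 gt_eqF //= mulf_eq0 pnatr_eq0 /= expf_eq0 /=.
by rewrite subr_eq0 eq_sym pnatr_eq1.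
Qed.

End Points.

(** * Choice of parameters and the exponential bound *)

Lemma expn3_lower j i r : (3 ^ (2 * j + i) <= r.+1 * 2 ^ (2 * j + i))%N ->
  (2 ^ j <= r.+1)%N.
Proof.
have p : (0 < 2 ^ (2 * j + i))%N by rewrite expn_gt0.
move=> le; rewrite -(leq_pmul2r p); apply: leq_trans le.
rewrite !(expnD _ (2 * j)%N) !(expnM _ 2 j) mulnA -expnMn.
(* Every two coordinates gain a factor 2, since [2 * 2 ^ 2 = 8] is at most [3 ^ 2]. *)
apply: leq_mul; first by case: j {p} => // j; rewrite leq_exp2r.
by case: i {p} => // i; rewrite leq_exp2r.
Qed.

Lemma gadget_extension_bound (R : realType) (n k m r : nat) (P : set (edge_vec R n)) :
  n = (1 + 2 * k + m)%N -> (m.+2 <= k)%N -> odd k -> (4 < k)%N ->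
  COMB_deg R n `<=` P -> P `<=` COMB R n -> has_extension P r ->
  (3 ^ m <= r.+1 * 2 ^ m)%N.
Proof.
move=> en m2k ok k4.
have e : #|{: vertex k m}| = n by rewrite card_option !card_sum !card_ord; lia.
pose phi (v : vertex k m) : 'I_n := cast_ord e (enum_rank v).
pose psi (i : 'I_n) : vertex k m := enum_val (cast_ord (esym e) i).
apply: (@COMB_extension_lower_bound R n k m phi psi) => // u.
  by rewrite /psi /phi cast_ordK enum_rankK.
by rewrite /psi /phi enum_valK cast_ordKV.
Qed.

Lemma COMB_between_bound (R : realType) (n r : nat) (P : set (edge_vec R n)) :
  (64 <= n)%N -> COMB_deg R n `<=` P -> P `<=` COMB R n -> has_extension P r ->
  (2 ^ (2 * (n %/ 16) - 1) <= r)%N.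
Proof.
move=> n64 degP PC ext.
(* The remainder [i] makes [n - 1 - m] congruent to 2 modulo 4, so that [k] is odd; [m] is about
   [n / 4] and [k] about [3 * n / 8]. *)
pose q := (n %/ 16)%N; pose i := ((n + 1) %% 4)%N.
pose m := (2 * (2 * q) + i)%N.
pose k := ((n - 1 - m) %/ 2)%N.
have en : n = (1 + 2 * k + m)%N by rewrite /k /m /i /q; lia.
have m2k : (m.+2 <= k)%N by rewrite /k /m /i /q; lia.
have ok : odd k by move: en; rewrite /k /m /i /q; lia.
have k4 : (4 < k)%N by rewrite /k /m /i /q; lia.
have := expn3_lower (gadget_extension_bound en m2k ok k4 degP PC ext).
(* Giving up a factor 2 absorbs the extra rectangle in [r.+1]. *)
rewrite -/q; have : (0 < 2 ^ (2 * q - 1))%N by rewrite expn_gt0.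
have -> : (2 ^ (2 * q) = 2 * 2 ^ (2 * q - 1))%N.
  by rewrite -expnS; congr (2 ^ _)%N; rewrite /q; lia.
by lia.
Qed.

Theorem theorem1 (R : realType) :
  exists2 c : R, 0 < c &
  exists n0 : nat, forall n : nat, (n0 <= n)%N ->
    2 `^ (c * n%:R) <= (xc (COMB R n))%:R /\
    2 `^ (c * n%:R) <= (xc (COMB_deg R n))%:R.
Proof.
(* For [q = n %/ 16], at least 4 here, [n <= 16 * q + 15 <= 32 * (2 * q - 1)]. *)
exists (32%:R^-1); first by rewrite invr_gt0.
exists 64%N => n n64.
have pow (P : set (edge_vec R n)) : COMB_deg R n `<=` P -> P `<=` COMB R n ->
    (exists r, has_extension P r) -> 2 `^ (32%:R^-1 * n%:R) <= (xc P)%:R :> R.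
  move=> degP PC ex.
  have : (2 ^ (2 * (n %/ 16) - 1) <= xc P)%N.
    by apply: xc_ge => // r; apply: COMB_between_bound.
  rewrite -(ler_nat R) natrX => /(le_trans _); apply.
  rewrite -powR_mulrn ?ler0n //; apply: ler_powR; first by rewrite ler1n.
  rewrite ler_pdivrMl // -natrM ler_nat; lia.
split; apply: pow => //; try by move=> x [].
  exact: COMB_extension.
exact: COMB_deg_extension.
Qed.
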